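(* Let $J=\Delta+F$ be a Jacobi operator, where $F$ has finite rank, such that the rank of $F$ is known a priori. Then the point spectrum $\sigma_p(J)$ is computable with error control in the Hausdorff metric.
   Context: A Jacobi operator $J$ is a bounded self-adjoint operator on $\ell^2(\{0,1,2,\dots\})$ given by a symmetric tridiagonal matrix with real diagonal entries $\alpha_k$ and off-diagonal entries $\beta_k>0$. The free Jacobi operator $\Delta$ has diagonal entries $0$ and off-diagonal entries $\tfrac12$. The point spectrum $\sigma_p(J)$ is the set of eigenvalues of $J$. The Hausdorff metric on compact subsets of $\mathbb C$ is $d_H(A,B)=\max\{\sup_{a\in A}\mathrm{dist}(a,B),\sup_{b\in B}\mathrm{dist}(b,A)\}$, with $d_H(\emptyset,\emptyset)=0$ and $d_H(\emptyset,A)=\infty$ for $A\ne\emptyset$. Computational model. The input is the operator $J$, which can be accessed only by reading individual matrix entries, together with the integer $\mathrm{rank}(F)$. A general algorithm is a map $\Gamma$ from inputs to outputs (here, compact subsets of $\mathbb R$) such that for each input $A$ the output $\Gamma(A)$ depends only on a finite set $\Lambda_\Gamma(A)$ of entries of $A$, and if $B$ is an input whose entries agree with those of $A$ on $\Lambda_\Gamma(A)$ then $\Lambda_\Gamma(B)=\Lambda_\Gamma(A)$. Exact real-number arithmetic is assumed: algorithms perform finitely many arithmetic operations and comparisons on real numbers, starting from the entries read. A set-valued function $\Xi$ of the input is computable with error control if there are such algorithms $\Gamma_1,\Gamma_2,\dots$ with $\Gamma_N(A)\to\Xi(A)$ in $d_H$ as $N\to\infty$ for every input $A$, and for each input $A$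 and each $\epsilon>0$ one can compute (in the same sense) an $N$ for which $d_H(\Gamma_N(A),\Xi(A))<\epsilon$ is guaranteed. *)

(* Defs.v *)
(* Real analysis and complex numbers: Stdlib's R with Coquelicot. *)
From Stdlib Require Import Reals List Arith.
From Coquelicot Require Import Coquelicot.
Open Scope R_scope.

(** * Operators on l^2({0,1,2,...}) *)

Definition seqC := nat -> C.
Definition imatrix := nat -> nat -> R.

Definition l2 (u : seqC) : Prop := ex_series (fun k => Cmod (u k) ^ 2).

Definition l2norm (u : seqC) : R := sqrt (Series (fun k => Cmod (u k) ^ 2)).

Definition inner (u v : seqC) : C :=
  (Series (fun k => Re (u k * Cconj (v k))%C),
   Series (fun k => Im (u k * Cconj (v k))%C)).

Definition bounded_op (T : seqC -> seqC) : Prop :=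
  exists m : R, forall u, l2 u -> l2 (T u) /\ l2norm (T u) <= m * l2norm u.

(* For a bounded, everywhere defined operator, symmetry is self-adjointness. *)
Definition self_adjoint (T : seqC -> seqC) : Prop :=
  forall u v, l2 u -> l2 v -> inner (T u) v = inner u (T v).

Definition tridiag (a b : nat -> R) : imatrix := fun i j =>
  if Nat.eqb i j then a i
  else if Nat.eqb (S i) j then b i
  else if Nat.eqb i (S j) then b j
  else 0.

(* All matrices below are tridiagonal, so row i has no nonzero entry beyond
   column i+1 and the sum over columns 0..i+1 is the full matrix product. *)
Definition mat_op (M : imatrix) (u : seqC) : seqC :=
  fun i => sum_n (fun j => RtoC (M i j) * u j)%C (S i).

Record jacobi := Jacobi {
  alpha : nat -> R;
  beta : nat -> R;
  beta_pos : forall k, 0 < beta k;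
  jacobi_bounded : bounded_op (mat_op (tridiag alpha beta));
  jacobi_self_adjoint : self_adjoint (mat_op (tridiag alpha beta))
}.

Definition entry (J : jacobi) : imatrix := tridiag (alpha J) (beta J).

Definition Delta : imatrix := tridiag (fun _ => 0) (fun _ => 1 / 2).

(* The F of J = Delta + F. *)
Definition perturbation (J : jacobi) : imatrix :=
  fun i j => entry J i j - Delta i j.

(* The range of T on l^2 has a basis e_1, ..., e_r (over C). *)
Definition has_rank (T : seqC -> seqC) (r : nat) : Prop :=
  exists e : nat -> seqC,
    (forall i, (1 <= i <= r)%nat ->
       exists u, l2 u /\ forall k, e i k = T u k) /\
    (forall c : nat -> C,
       (forall k, sum_n_m (fun i => c i * e i k)%C 1 r = RtoC 0) ->
       forall i, (1 <= i <= r)%nat -> c i = RtoC 0) /\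
    (forall u, l2 u -> exists c : nat -> C,
       forall k, T u k = sum_n_m (fun i => c i * e i k)%C 1 r).

Definition point_spectrum (J : jacobi) : C -> Prop := fun lambda =>
  exists u : seqC, l2 u /\ (exists k, u k <> RtoC 0) /\
    forall k, mat_op (entry J) u k = (lambda * u k)%C.

(** * Hausdorff metric *)

Definition dist_to (a : C) (B : C -> Prop) : Rbar :=
  Glb_Rbar (fun r => exists b, B b /\ r = Cmod (a - b)%C).

Definition sup_dist (A B : C -> Prop) : Rbar :=
  Rbar_lub (fun r => exists a, A a /\ r = dist_to a B).

Definition Rbar_max (x y : Rbar) : Rbar := if Rbar_le_dec x y then y else x.

(* Suprema are taken in [0, +oo] (whence the 0) and the distance to the empty
   set is +oo, which gives the stated conventions for empty sets. *)
Definition hausdorff (A B : C -> Prop) : Rbar :=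
  Rbar_max (Finite 0) (Rbar_max (sup_dist A B) (sup_dist B A)).

Lemma hausdorff_empty_empty :
  hausdorff (fun _ => False) (fun _ => False) = Finite 0.
Proof.
  assert (H : forall B, sup_dist (fun _ => False) B = m_infty).
  { intros B. apply Rbar_is_lub_unique. split.
    - intros x [a [[] _]].
    - intros b _. exact I. }
  unfold hausdorff. rewrite !H. unfold Rbar_max.
  destruct (Rbar_le_dec m_infty m_infty);
    destruct (Rbar_le_dec (Finite 0) m_infty) as [h|h]; easy.
Qed.

Lemma hausdorff_empty_nonempty (A : C -> Prop) (a : C) :
  A a -> hausdorff (fun _ => False) A = p_infty.
Proof.
  intros Ha.
  assert (H0 : sup_dist A (fun _ => False) = p_infty).
  { apply Rbar_is_lub_unique. split.
    - intros x _. destruct x; exact I.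
    - intros b Hb. apply Hb. exists a. split; [exact Ha|].
      symmetry. apply is_glb_Rbar_unique. split.
      + intros x [z [[] _]].
      + intros x _. destruct x; exact I. }
  unfold hausdorff. rewrite H0. unfold Rbar_max.
  destruct (Rbar_le_dec (sup_dist (fun _ => False) A) p_infty) as [h|h].
  - destruct (Rbar_le_dec (Finite 0) p_infty) as [h'|h']; [easy|].
    exfalso. apply h'. exact I.
  - exfalso. apply h.
    destruct (sup_dist (fun _ => False) A); exact I.
Qed.

Definition embed (S : R -> Prop) : C -> Prop :=
  fun z => exists x, S x /\ z = RtoC x.

(** * A real random access machine with an oracle for matrix entries *)

(* Index arithmetic on natural-number registers. *)
Inductive nexp :=
| NConst (n : nat)
| NReg (i : nat)
| NAdd (e f : nexp)
| NSub (e f : nexp)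
| NMul (e f : nexp).

(* Real registers are addressed by an index expression, so that the real
   memory is an array of unbounded length. *)
Inductive rexp :=
| RConst (z : Z)
| ROfNat (e : nexp)
| RReg (i : nexp)
| RAdd (e f : rexp)
| RSub (e f : rexp)
| RMul (e f : rexp)
| RDiv (e f : rexp).

Inductive test :=
| TRlt (e f : rexp)
| TNlt (e f : nexp)
| TNot (t : test)
| TAnd (t u : test).

Inductive prog :=
| Skip
| NSet (i : nat) (e : nexp)
| RSet (i : nexp) (e : rexp)
| Read (d i j : nexp)        (* real register d := entry (i, j) *)
| Emit (e : rexp)            (* append a point to the output *)
| Seq (p q : prog)
| If (t : test) (p q : prog)
| While (t : test) (p : prog).

Record state := State {
  nreg : nat -> nat;
  rreg : nat -> R;
  reads : list (nat * nat);  (* the positions read so far *)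
  output : list R
}.

Definition upd {X : Type} (f : nat -> X) (i : nat) (x : X) : nat -> X :=
  fun k => if Nat.eqb k i then x else f k.

Fixpoint neval (s : state) (e : nexp) : nat :=
  match e with
  | NConst n => n
  | NReg i => nreg s i
  | NAdd e f => neval s e + neval s f
  | NSub e f => neval s e - neval s f
  | NMul e f => neval s e * neval s f
  end.

Fixpoint reval (s : state) (e : rexp) : R :=
  match e with
  | RConst z => IZR z
  | ROfNat e => INR (neval s e)
  | RReg i => rreg s (neval s i)
  | RAdd e f => reval s e + reval s f
  | RSub e f => reval s e - reval s f
  | RMul e f => reval s e * reval s f
  | RDiv e f => reval s e / reval s f
  end.

(* No division by zero occurs; otherwise the machine is stuck. *)
Fixpoint rdefined (s : state) (e : rexp) : Prop :=
  match e with
  | RConst _ | ROfNat _ | RReg _ => True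
  | RAdd e f | RSub e f | RMul e f => rdefined s e /\ rdefined s f
  | RDiv e f => rdefined s e /\ rdefined s f /\ reval s f <> 0
  end.

Fixpoint teval (s : state) (t : test) : Prop :=
  match t with
  | TRlt e f => reval s e < reval s f
  | TNlt e f => (neval s e < neval s f)%nat
  | TNot t => ~ teval s t
  | TAnd t u => teval s t /\ teval s u
  end.

Fixpoint tdefined (s : state) (t : test) : Prop :=
  match t with
  | TRlt e f => rdefined s e /\ rdefined s f
  | TNlt _ _ => True
  | TNot t => tdefined s t
  | TAnd t u => tdefined s t /\ tdefined s u
  end.

(* exec M p s s': with oracle M, the program p started in s halts in s'. *)
Inductive exec (M : imatrix) : prog -> state -> state -> Prop :=
| exec_Skip s : exec M Skip s s
| exec_NSet s i e :
    exec M (NSet i e) s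
      (State (upd (nreg s) i (neval s e)) (rreg s) (reads s) (output s))
| exec_RSet s i e : rdefined s e ->
    exec M (RSet i e) s
      (State (nreg s) (upd (rreg s) (neval s i) (reval s e))
         (reads s) (output s))
| exec_Read s d i j :
    exec M (Read d i j) s
      (State (nreg s)
         (upd (rreg s) (neval s d) (M (neval s i) (neval s j)))
         ((neval s i, neval s j) :: reads s) (output s))
| exec_Emit s e : rdefined s e ->
    exec M (Emit e) s
      (State (nreg s) (rreg s) (reads s) (output s ++ reval s e :: nil))
| exec_Seq p q s s1 s2 :
    exec M p s s1 -> exec M q s1 s2 -> exec M (Seq p q) s s2
| exec_If_true t p q s s' :
    tdefined s t -> teval s t -> exec M p s s' -> exec M (If t p q) s s'
| exec_If_false t p q s s' :
    tdefined s t -> ~ teval s t -> exec M q s s' -> exec M (If t p q) s s'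
| exec_While_true t p s s1 s2 :
    tdefined s t -> teval s t -> exec M p s s1 ->
    exec M (While t p) s1 s2 -> exec M (While t p) s s2
| exec_While_false t p s :
    tdefined s t -> ~ teval s t -> exec M (While t p) s s.

(* The integer r is in natural register 0, the real x in real register 0. *)
Definition init (r : nat) (x : R) : state :=
  State (upd (fun _ => O) O r) (upd (fun _ => 0) O x) nil nil.

(** * Algorithms and computability with error control *)

(* An input is a Jacobi operator J together with an integer r; Omega is the
   class of admissible inputs.  The integer is handed to the algorithm, so only
   reading entries of J is subject to the finiteness condition. *)

Definition general_algorithm {O : Type} (Omega : jacobi -> nat -> Prop)
    (Gamma : jacobi -> nat -> O)
    (Lambda : jacobi -> nat -> list (nat * nat)) : Prop :=
  forall (A B : jacobi) (r : nat), Omega A r -> Omega B r ->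
    (forall i j, In (i, j) (Lambda A r) -> entry B i j = entry A i j) ->
    (forall p, In p (Lambda B r) <-> In p (Lambda A r)) /\
    Gamma B r = Gamma A r.

(* p, given also the real parameter x, halts on every admissible input after
   reading exactly the entries in Lambda, with result Gamma. *)
Definition computed_by {O : Type} (p : prog) (x : R) (result : state -> O)
    (Omega : jacobi -> nat -> Prop) (Gamma : jacobi -> nat -> O)
    (Lambda : jacobi -> nat -> list (nat * nat)) : Prop :=
  forall (A : jacobi) (r : nat), Omega A r ->
    exists s, exec (entry A) p (init r x) s /\
      Gamma A r = result s /\
      (forall q, In q (Lambda A r) <-> In q (reads s)).

(* A finite, hence compact, subset of the real line. *)
Definition set_result (s : state) : R -> Prop := fun x => In x (output s).

Definition nat_result (s : state) : nat := nreg s 0%nat.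

Definition computable_with_error_control
    (Omega : jacobi -> nat -> Prop) (Xi : jacobi -> C -> Prop) : Prop :=
  exists (Gamma : nat -> jacobi -> nat -> R -> Prop)
         (Lambda : nat -> jacobi -> nat -> list (nat * nat)),
    (forall N,
       general_algorithm Omega (Gamma N) (Lambda N) /\
       exists p, computed_by p 0 set_result Omega (Gamma N) (Lambda N)) /\
    (forall A r, Omega A r -> forall eps : R, 0 < eps ->
       exists N0, forall N, (N0 <= N)%nat ->
         Rbar_lt (hausdorff (embed (Gamma N A r)) (Xi A)) eps) /\
    (* one program, taking eps as a real input, computes the index N *)
    (exists (p : prog) (index : R -> jacobi -> nat -> nat)
            (LambdaI : R -> jacobi -> nat -> list (nat * nat)),
       forall eps : R, 0 < eps ->
         general_algorithm Omega (index eps) (LambdaI eps) /\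
         computed_by p eps nat_result Omega (index eps) (LambdaI eps) /\
         forall A r, Omega A r ->
           Rbar_lt (hausdorff (embed (Gamma (index eps A r) A r)) (Xi A)) eps).

(* Main.v *)
Require Import Defs.
From Stdlib Require Import Reals List Arith Lia Lra Psatz.
From Stdlib Require Import Classical ClassicalEpsilon FunctionalExtensionality.
From Coquelicot Require Import Coquelicot.
Open Scope R_scope.

(* F is tridiagonal, so eliminating its columns one at a time counts the rank
   of the leading columns; once the count reaches rank(F), F has been read
   completely and J is free from some index K on.  A square-summable solution
   of J u = lambda u must then decay like w^(-k) beyond K, where
   lambda = +-(w + 1/w)/2 with w > 1, so the eigenvalues are the zeros w > 1 of
   the last term of a finite Sturm sequence P_0, ..., P_(K+1) of functions of w.
   The number of sign changes of this sequence is nonincreasing in w and drops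
   across (v, w] if and only if the last term has a zero there.  Comparing it at
   the points 1, 1 + h, 1 + 2h, ... until it vanishes locates every eigenvalue
   up to h, with exact tests only: eigenvalues close to 1 or to one another
   need no special care, and the mesh h alone controls the error. *)

(** * Sturm sequences with increasing coefficients *)

(** The parameter is [w] rather than lambda because on [w >= 1] every Sturm coefficient, including
    the modified last one, is continuous and strictly increasing in [w], which is what makes the
    sign count monotone. A zero at [w = 1] belongs to a bounded, non-decaying solution and gives no
    eigenvalue; the cells [(v, w]] are open on the left and the first starts at [1], so such a zero
    is never reported, while a zero arbitrarily close above [1] is. The Hausdorff metric asks only
    that each eigenvalue have a reported point nearby and conversely, so several zeros in one cell
    need not be separated, and an empty point spectrum produces an empty output without any test for
    emptiness. The sign [sg = -1] handles eigenvalues below [-1] by passing to [-J], which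
    conjugation with alternating signs turns back into a matrix with positive off-diagonal entries.
    The search stops because for large [w] the coefficients dominate and all terms are positive. *)

Section Sturm.

Variable c : nat -> R -> R.
Variable q : nat -> R.
Hypothesis q_pos : forall k, 0 < q (S k).
Hypothesis c_incr : forall k x y, 1 <= x -> x < y -> c k x < c k y.
Hypothesis c_cont : forall k x, 1 <= x -> continuous (c k) x.

(** In the model case [c k] is the spectral parameter minus a diagonal entry and [q k] a squared
    off-diagonal entry, and the first components are the characteristic polynomials of the leading
    blocks. The second component carries the previous term, starting from [P_(-1) = 0]. *)
Fixpoint sturm2 (k : nat) (x : R) : R * R :=
  match k with
  | O => (1, 0)
  | S k => (c k x * fst (sturm2 k x) - q k * snd (sturm2 k x),
            fst (sturm2 k x))
  end.

Definition sturm (k : nat) (x : R) : R := fst (sturm2 k x).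

(** A vanishing term is charged to the pair that it begins, not to the pair that it ends. An
    interior zero then counts once, as its neighbours have opposite signs, and a zero of the last
    term counts nothing, which makes the count right-continuous. *)
Definition drops (y y' : R) : Prop := y = 0 \/ y * y' < 0.

Fixpoint variation (k : nat) (x : R) : nat :=
  match k with
  | O => O
  | S k => if excluded_middle_informative (drops (sturm k x) (sturm (S k) x))
           then S (variation k x) else variation k x
  end.

Lemma sturm_0 x : sturm 0 x = 1.
Proof. reflexivity. Qed.

Lemma sturm_1 x : sturm 1 x = c 0 x.
Proof. unfold sturm; simpl; ring. Qed.

Lemma sturm_SS k x :
  sturm (S (S k)) x = c (S k) x * sturm (S k) x - q (S k) * sturm k x.
Proof. reflexivity. Qed.

Lemma variation_S k x :
  drops (sturm k x) (sturm (S k) x) -> variation (S k) x = S (variation k x).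
Proof.
  intros H; simpl; destruct (excluded_middle_informative _); tauto.
Qed.

Lemma variation_S_not k x :
  ~ drops (sturm k x) (sturm (S k) x) -> variation (S k) x = variation k x.
Proof.
  intros H; simpl; destruct (excluded_middle_informative _); tauto.
Qed.

Lemma sturm_consecutive k x : sturm k x = 0 -> sturm (S k) x <> 0.
Proof.
  induction k as [|k IH].
  - rewrite sturm_0; lra.
  - intros H H'; rewrite sturm_SS, H in H'.
    assert (sturm k x = 0) by (pose proof (q_pos k); nra).
    tauto.
Qed.

(* The order of the slopes [y' / y], where [y = 0] stands for the slope
   [-oo]. *)
Definition slope_lt (y y' z z' : R) : Prop :=
  z <> 0 /\ (y = 0 \/ (y <> 0 /\ y' / y < z' / z)).

(** The slope [s = y' / y] is mapped to [ca - p / s], which increases in [s] on each side of 0 and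
    in [ca]. Agreement of [drops] keeps both slopes on the same side: negative or [-oo] for a drop,
    nonnegative otherwise. *)
Lemma slope_step ca cb p y y' z z' :
  0 < p -> ca < cb -> (y = 0 -> y' <> 0) ->
  slope_lt y y' z z' -> (drops y y' <-> drops z z') ->
  slope_lt y' (ca * y' - p * y) z' (cb * z' - p * z).
Proof.
  intros Hp Hc Hy [Hz H] Hd.
  assert (Hz' : z' <> 0).
  { intros E; subst z'.
    assert (Hn : ~ drops z 0) by (unfold drops; nra).
    destruct H as [H|[H1 H2]]; [apply Hn, Hd; now left|].
    apply Hn, Hd; right.
    replace (0 / z) with 0 in H2 by (field; auto).
    replace (y * y') with (y ^ 2 * (y' / y)) by (field; auto).
    pose proof (pow2_gt_0 y H1); nra. }
  split; [exact Hz'|].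
  destruct (Req_dec y' 0) as [E|E]; [now left|right; split; [exact E|]].
  replace ((ca * y' - p * y) / y') with (ca - p * (y / y')) by (field; auto).
  replace ((cb * z' - p * z) / z') with (cb - p * (z / z')) by (field; auto).
  enough (z / z' <= y / y') by nra.
  destruct H as [H|[H1 H2]].
  - subst y. replace (0 / y') with 0 by (field; auto).
    assert (D : drops z z') by (apply Hd; now left).
    destruct D as [D|D]; [tauto|].
    replace (z / z') with (z * z' * / (z' ^ 2)) by (field; auto).
    assert (0 < / z' ^ 2) by (apply Rinv_0_lt_compat, pow2_gt_0; auto).
    nra.
  - replace (z / z') with (/ (z' / z)) by (field; auto).
    replace (y / y') with (/ (y' / y)) by (field; auto).
    left. apply Rinv_lt_contravar; [|exact H2].
    assert (Dy : y * y' < 0 <-> z * z' < 0) by (unfold drops in Hd; tauto).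
    replace (y' / y * (z' / z)) with ((y * y') * (z * z') * / (y ^ 2 * z ^ 2))
      by (field; auto).
    assert (0 < / (y ^ 2 * z ^ 2)).
    { apply Rinv_0_lt_compat, Rmult_lt_0_compat; apply pow2_gt_0; auto. }
    assert (y * y' <> 0) by (apply Rmult_integral_contrapositive; auto).
    assert (z * z' <> 0) by (apply Rmult_integral_contrapositive; auto).
    apply Rmult_lt_0_compat; [|assumption].
    destruct (Rlt_dec (y * y') 0); destruct (Rlt_dec (z * z') 0); try tauto; nra.
Qed.

(** Here the first slope is nonnegative and the second negative or [-oo], so the new slopes are
    separated by [ca < cb]: the first is at most [ca], the second at least [cb]. No order of the old
    slopes is required. *)
Lemma slope_step_cross ca cb p y y' z z' :
  0 < p -> ca < cb -> ~ drops y y' -> drops z z' -> (z = 0 -> z' <> 0) ->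
  slope_lt y' (ca * y' - p * y) z' (cb * z' - p * z).
Proof.
  intros Hp Hc Hy Hz Hz0. unfold drops in *.
  assert (Hz' : z' <> 0) by (intros E; subst; apply Hz0; nra).
  split; [exact Hz'|].
  destruct (Req_dec y' 0) as [E|E]; [now left|right; split; [exact E|]].
  replace ((ca * y' - p * y) / y') with (ca - p * ((y * y') * / (y' ^ 2)))
    by (field; auto).
  replace ((cb * z' - p * z) / z') with (cb - p * ((z * z') * / (z' ^ 2)))
    by (field; auto).
  assert (0 < / (y' ^ 2)) by (apply Rinv_0_lt_compat, pow2_gt_0; auto).
  assert (0 < / (z' ^ 2)) by (apply Rinv_0_lt_compat, pow2_gt_0; auto).
  assert (0 <= y * y') by (apply Rnot_lt_le; tauto).
  assert (z * z' <= 0) by (destruct Hz; [subst; lra|lra]).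
  assert (0 <= (y * y') * / (y' ^ 2)) by (apply Rmult_le_pos; lra).
  assert ((z * z') * / (z' ^ 2) <= 0) by nra.
  nra.
Qed.

(* [atan (slope) - PI * variation], a discrete Pruefer angle, is strictly
   increasing in [x]. *)
Lemma variation_slope k a b : 1 <= a -> a < b ->
  (variation k b < variation k a)%nat \/
  (variation k b = variation k a /\
   slope_lt (sturm k a) (sturm (S k) a) (sturm k b) (sturm (S k) b)).
Proof.
  intros Ha Hab. induction k as [|k IH].
  - right; split; [reflexivity|].
    rewrite !sturm_0, !sturm_1. pose proof (c_incr 0 a b Ha Hab).
    split; [lra|right; split; [lra|]]. rewrite !Rdiv_1_r; lra.
  - pose proof (c_incr (S k) a b Ha Hab) as Hc.
    pose proof (q_pos k) as Hq.
    pose proof (sturm_consecutive k a) as Na.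
    pose proof (sturm_consecutive k b) as Nb.
    rewrite (sturm_SS k a), (sturm_SS k b).
    destruct (classic (drops (sturm k a) (sturm (S k) a))) as [Da|Da];
    destruct (classic (drops (sturm k b) (sturm (S k) b))) as [Db|Db].
    + rewrite !variation_S by assumption.
      destruct IH as [IH|[IH IH']]; [left; lia|right; split; [lia|]].
      apply slope_step; auto; tauto.
    + rewrite (variation_S k a), (variation_S_not k b) by assumption.
      left; lia.
    + rewrite (variation_S k b), (variation_S_not k a) by assumption.
      destruct IH as [IH|[IH IH']].
      (* The extra drop at [b] may use up the earlier deficit exactly; the slope order is then
         re-established from scratch. *)
      * destruct (Nat.eq_dec (S (variation k b)) (variation k a)) as [E|E];
          [right; split; [exact E|]|left; lia].
        apply slope_step_cross; auto.
      (* A drop at [b] means a negative slope there, hence a still smaller slope at [a], which would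
         be a drop too. *)
      * exfalso. apply Da. destruct IH' as [H1 [H2|[H2 H3]]]; [now left|right].
        destruct Db as [Db|Db]; [tauto|].
        replace (sturm k a * sturm (S k) a)
          with ((sturm k a) ^ 2 * (sturm (S k) a / sturm k a))
          by (field; auto).
        assert (sturm (S k) b / sturm k b < 0).
        { replace (sturm (S k) b / sturm k b)
            with (sturm k b * sturm (S k) b * / (sturm k b ^ 2))
            by (field; auto).
          assert (0 < / (sturm k b ^ 2))
            by (apply Rinv_0_lt_compat, pow2_gt_0; auto).
          nra. }
        pose proof (pow2_gt_0 _ H2). nra.
    + rewrite !variation_S_not by assumption.
      destruct IH as [IH|[IH IH']]; [left; lia|right; split; [lia|]].
      apply slope_step; auto; tauto.
Qed.

Lemma variation_decr k a b : 1 <= a -> a <= b ->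
  (variation k b <= variation k a)%nat.
Proof.
  intros Ha [H|H]; [|subst; lia].
  destruct (variation_slope k a b Ha H); lia.
Qed.

(** At a zero [s] of the last term the final slope is 0, so the final pair does not drop at [s].
    Either the earlier count is already smaller there, or the final slope at [a] is below 0 and the
    final pair drops at [a]. *)
Lemma variation_drop_of_root m a b s :
  1 <= a -> a < s <= b -> sturm m s = 0 ->
  (variation m b < variation m a)%nat.
Proof.
  intros Ha [H1 H2] Hs.
  apply Nat.le_lt_trans with (variation m s).
  { apply variation_decr; lra. }
  destruct m as [|k]; [rewrite sturm_0 in Hs; lra|].
  assert (Hk : sturm k s <> 0)
    by (intros E; now apply (sturm_consecutive k s)).
  rewrite (variation_S_not k s).
  2: { unfold drops. rewrite Hs. lra. }
  destruct (variation_slope k a s Ha H1) as [H|[H H']].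
  - simpl; destruct (excluded_middle_informative _); lia.
  - rewrite variation_S; [lia|].
    destruct H' as [_ [H'|[H' H'']]]; [now left|right].
    rewrite Hs in H''. replace (0 / sturm k s) with 0 in H'' by (field; auto).
    replace (sturm k a * sturm (S k) a)
      with ((sturm k a) ^ 2 * (sturm (S k) a / sturm k a)) by (field; auto).
    pose proof (pow2_gt_0 _ H'). nra.
Qed.

Lemma sturm_continuous k x : 1 <= x -> continuous (sturm k) x.
Proof.
  intros Hx.
  enough (H : continuous (sturm k) x /\ continuous (sturm (S k)) x)
    by exact (proj1 H).
  induction k as [|k [IH1 IH2]].
  - split; [apply continuous_const|].
    apply continuous_ext with (c 0); [intros; now rewrite sturm_1|auto].
  - split; [exact IH2|].
    apply continuous_ext
      with (fun x => minus (mult (c (S k) x) (sturm (S k) x))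
                           (mult (q (S k)) (sturm k x))).
    { intros; reflexivity. }
    apply (continuous_minus (V := R_NormedModule)).
    + apply (continuous_mult (K := R_AbsRing)); auto.
    + apply (continuous_mult (K := R_AbsRing)); auto.
      apply continuous_const.
Qed.

Lemma locally_same_sign (f : R -> R) x :
  continuous f x -> f x <> 0 -> locally x (fun y => 0 < f x * f y).
Proof.
  intros Hf Hx.
  apply (Hf (fun z => 0 < f x * z)).
  assert (Hp : 0 < Rabs (f x)) by now apply Rabs_pos_lt.
  exists (mkposreal _ Hp). intros z Hz.
  change (Rabs (z - f x) < Rabs (f x)) in Hz.
  unfold Rabs in Hz; destruct (Rcase_abs _); destruct (Rcase_abs _); nra.
Qed.

(** Strong induction, because an interior zero is crossed in one stride of two pairs: its neighbours
    have opposite signs near [s], so the two pairs contribute exactly one drop whatever the sign of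
    the middle term. Elsewhere the signs of a pair persist. *)
Lemma variation_locally_const k s : 1 <= s -> sturm k s <> 0 ->
  locally s (fun x => variation k x = variation k s).
Proof.
  intros Hs. revert k.
  apply (well_founded_induction_type lt_wf (fun k => sturm k s <> 0 ->
    locally s (fun x => variation k x = variation k s))).
  intros [|k] IH Hk; [now apply filter_forall|].
  assert (C : forall j, sturm j s <> 0 ->
            locally s (fun y => 0 < sturm j s * sturm j y)).
  { intros j; apply locally_same_sign. now apply sturm_continuous. }
  destruct (Req_dec (sturm k s) 0) as [E|E].
  - destruct k as [|k]; [rewrite sturm_0 in E; lra|].
    assert (E' : sturm k s <> 0)
      by (intros E'; now apply (sturm_consecutive k s)).
    assert (Hopp : sturm k s * sturm (S (S k)) s < 0).
    { rewrite sturm_SS, E. pose proof (q_pos k).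
      pose proof (pow2_gt_0 _ E'). nra. }
    pose proof (IH k ltac:(lia) E') as H.
    pose proof (filter_and _ _ H (filter_and _ _ (C _ E') (C _ Hk))) as H'.
    clear IH C H. revert H'. apply filter_imp. intros x [Hx [H1 H2]].
    transitivity (S (variation k s)).
    + assert (Hx' : sturm k x * sturm (S (S k)) x < 0).
      { pose proof (Rmult_lt_0_compat _ _ H1 H2) as H12. nra. }
      assert (Hx0 : sturm k x <> 0) by nra.
      rewrite <- Hx.
      destruct (total_order_T (sturm k x * sturm (S k) x) 0) as [[T|T]|T].
      * rewrite variation_S_not; [apply variation_S; now right|].
        intros [D|D]; nra.
      * rewrite variation_S; [f_equal; apply variation_S_not|].
        -- intros [D|D]; nra.
        -- left. nra.
      * rewrite variation_S; [f_equal; apply variation_S_not|].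
        -- intros [D|D]; nra.
        -- right. nra.
    + rewrite variation_S by now left.
      rewrite variation_S_not; [reflexivity|].
      unfold drops; rewrite E; lra.
  - pose proof (IH k ltac:(lia) E) as H.
    pose proof (filter_and _ _ H (filter_and _ _ (C _ E) (C _ Hk))) as H'.
    clear IH C H. revert H'. apply filter_imp. intros x [Hx [H1 H2]].
    assert (D : drops (sturm k x) (sturm (S k) x) <->
                drops (sturm k s) (sturm (S k) s)).
    { assert (0 < (sturm k s * sturm k x) * (sturm (S k) s * sturm (S k) x))
        by nra.
      unfold drops. split; intros [D|D]; try nra; right; nra. }
    simpl. rewrite Hx.
    destruct (excluded_middle_informative _);
      destruct (excluded_middle_informative _); tauto.
Qed.

(** When the last term vanishes at [s], the final slope rises from 0 to a positive value to the
    right of [s], so the final pair still does not drop. *)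
Lemma variation_right_const m s : 1 <= s ->
  locally s (fun x => s < x -> variation m x = variation m s).
Proof.
  intros Hs.
  destruct (Req_dec (sturm m s) 0) as [E|E].
  2: { generalize (variation_locally_const m s Hs E). apply filter_imp; auto. }
  destruct m as [|k]; [rewrite sturm_0 in E; lra|].
  assert (Hk : sturm k s <> 0)
    by (intros E'; now apply (sturm_consecutive k s)).
  generalize (variation_locally_const k s Hs Hk). apply filter_imp.
  intros x Hx Hsx.
  rewrite (variation_S_not k s) by (unfold drops; rewrite E; lra).
  rewrite <- Hx. apply variation_S_not.
  destruct (variation_slope k s x Hs Hsx) as [H|[_ [H1 [H2|[_ H2]]]]];
    [lia|tauto|].
  rewrite E in H2. replace (0 / sturm k s) with 0 in H2 by (field; auto).
  intros [D|D]; [tauto|].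
  replace (sturm k x * sturm (S k) x)
    with ((sturm k x) ^ 2 * (sturm (S k) x / sturm k x)) in D by (field; auto).
  pose proof (pow2_gt_0 _ H1). nra.
Qed.

(** Without a zero in [(a, b]], the supremum [s] of the points whose count has not fallen below that
    of [a] still has such a count, and right-constancy pushes past it. *)
Lemma root_of_variation_drop m a b : 1 <= a -> a < b ->
  (variation m b < variation m a)%nat ->
  exists s, a < s <= b /\ sturm m s = 0.
Proof.
  intros Ha Hab Hv.
  apply NNPP; intros Hno.
  assert (NZ : forall s, a < s <= b -> sturm m s <> 0)
    by (intros s Hs E; apply Hno; eauto).
  clear Hno.
  set (E := fun x => a <= x <= b /\ (variation m a <= variation m x)%nat).
  destruct (completeness E) as [s [Hs1 Hs2]].
  { exists b. intros x [[_ H] _]; exact H. }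
  { exists a. split; [lra|lia]. }
  assert (Has : a <= s) by (apply Hs1; split; [lra|lia]).
  assert (Hsb : s <= b) by (apply Hs2; intros x [[_ H] _]; exact H).
  assert (Hvs : (variation m a <= variation m s)%nat).
  (* The left endpoint may itself be a zero, so two-sided local constancy is available only for
     [s > a]. *)
  { destruct (Req_dec a s) as [->|N]; [lia|].
    destruct (variation_locally_const m s ltac:(lra) (NZ s ltac:(lra)))
      as [e He].
    destruct (classic (exists x, E x /\ s - e < x)) as [[x [Hx Hx']]|Hn].
    - rewrite <- (He x); [apply Hx|].
      change (Rabs (x - s) < e).
      pose proof (Hs1 x Hx). rewrite Rabs_left1; lra.
    - exfalso. assert (s <= s - e).
      { apply Hs2. intros x Hx. apply Rnot_lt_le. eauto. }
      destruct e as [e He0]; simpl in *; lra. }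
  assert (Hsb' : s < b).
  { destruct Hsb as [H|H]; [exact H|subst; lia]. }
  destruct (variation_right_const m s ltac:(lra)) as [e He].
  set (x := s + Rmin (e / 2) (b - s)).
  assert (0 < e) by (destruct e; assumption).
  assert (Hx : 0 < Rmin (e / 2) (b - s)) by (apply Rmin_glb_lt; lra).
  pose proof (Rmin_l (e / 2) (b - s)). pose proof (Rmin_r (e / 2) (b - s)).
  assert (Hx' : variation m x = variation m s).
  { apply He; [|unfold x; lra].
    change (Rabs (x - s) < e). rewrite Rabs_right; unfold x; lra. }
  assert (x <= s); [|unfold x in *; lra].
  apply Hs1. split; [unfold x; lra|lia].
Qed.

(** The bound gives [P_(k+1) >= (1 + |q|) P_k - |q| P_(k-1) >= P_k] as long as the terms are
    nonnegative and nondecreasing, so the induction carries these two facts along. *)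
Lemma variation_zero k x : (forall j, (j < k)%nat -> 1 + Rabs (q j) <= c j x) ->
  variation k x = O /\ 0 < sturm k x /\ snd (sturm2 k x) <= sturm k x /\
  0 <= snd (sturm2 k x).
Proof.
  induction k as [|k IH]; intros H.
  - unfold sturm; simpl; repeat split; lra.
  - destruct IH as [IH1 [IH2 [IH3 IH4]]]; [intros j Hj; apply H; lia|].
    specialize (H k ltac:(lia)).
    assert (sturm k x <= sturm (S k) x).
    { unfold sturm in *; simpl. pose proof (Rle_abs (q k)).
      pose proof (Rabs_pos (q k)). nra. }
    repeat split.
    + rewrite variation_S_not; [exact IH1|]. intros [D|D]; nra.
    + lra.
    + assumption.
    + unfold sturm in *; simpl; lra.
Qed.

End Sturm.

(** * Linear independence in sequence spaces *)

(* Coquelicot's sums live in [AbelianMonoid.sort C_AbelianMonoid], which [ring]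
   does not recognize as [C]. *)
Ltac ring_C := match goal with |- @eq _ ?x ?y => change (@eq C x y) end; ring.

Definition lincomb (a : C) (x : seqC) (b : C) (y : seqC) : seqC :=
  fun k => (a * x k + b * y k)%C.

Fixpoint span (L : list seqC) (x : seqC) : Prop :=
  match L with
  | nil => forall k, x k = RtoC 0
  | g :: L => exists a, span L (lincomb 1 x (- a) g)
  end.

Fixpoint indep (L : list seqC) : Prop :=
  match L with
  | nil => True
  | g :: L => ~ span L g /\ indep L
  end.

Lemma span_ext L x y : (forall k, x k = y k) -> span L x -> span L y.
Proof. intros H. now replace y with x by (apply functional_extensionality, H). Qed.

Lemma span_lincomb L x y a b :
  span L x -> span L y -> span L (lincomb a x b y).
Proof.
  revert x y. induction L as [|g L IH]; simpl; intros x y.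
  - intros Hx Hy k. unfold lincomb. rewrite Hx, Hy. ring.
  - intros [s Hs] [t Ht]. exists (a * s + b * t)%C.
    eapply span_ext; [|exact (IH _ _ Hs Ht)].
    intros k; unfold lincomb; ring.
Qed.

Lemma span_zero L : span L (fun _ => RtoC 0).
Proof.
  induction L as [|g L IH]; simpl; [reflexivity|].
  exists (RtoC 0). eapply span_ext; [|exact IH]. intros k; unfold lincomb; ring.
Qed.

Lemma span_cons L g x : span L x -> span (g :: L) x.
Proof.
  intros H; exists (RtoC 0). eapply span_ext; [|exact H].
  intros k; unfold lincomb; ring.
Qed.

Lemma span_head L g : span (g :: L) g.
Proof.
  exists (RtoC 1). eapply span_ext; [|exact (span_zero L)].
  intros k; unfold lincomb; ring.
Qed.

Lemma span_incl L M : (forall g, In g L -> span M g) ->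
  forall x, span L x -> span M x.
Proof.
  induction L as [|g L IH]; simpl; intros H x.
  - intros Hx. eapply span_ext; [|apply span_zero]. intros k; now rewrite Hx.
  - intros [a Ha]. apply IH in Ha; [|auto].
    eapply span_ext; [|apply (span_lincomb _ _ _ 1 a Ha (H g (or_introl eq_refl)))].
    intros k; unfold lincomb; ring.
Qed.

Lemma span_in L g : In g L -> span L g.
Proof.
  induction L as [|h L IH]; [easy|].
  intros [->|H]; [apply span_head|apply span_cons; auto].
Qed.

(** Steinitz exchange: as [X] alone does not span [x], some element of [L] enters with a nonzero
    coefficient and can be traded for [x]. The tail [X] holds the vectors already exchanged. *)
Lemma span_exchange L X x : span (L ++ X) x -> ~ span X x ->
  exists L', S (length L') = length L /\
    forall y, span (L ++ X) y -> span (L' ++ x :: X) y.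
Proof.
  induction L as [|g L IH]; simpl; [tauto|].
  intros [a Ha] Hx.
  destruct (classic (span (L ++ X) x)) as [Hc|Hc].
  - destruct (IH Hc Hx) as [L' [H1 H2]].
    exists (g :: L'); split; [simpl; lia|].
    intros y [b Hb]. exists b; auto.
  - exists L; split; [reflexivity|].
    assert (Ha0 : a <> RtoC 0).
    { intros ->. apply Hc. eapply span_ext; [|exact Ha].
      intros k; unfold lincomb; ring. }
    assert (Hinc : forall z, span (L ++ X) z -> span (L ++ x :: X) z).
    { apply span_incl. intros z Hz. apply span_in.
      apply in_app_or in Hz. apply in_or_app. simpl; tauto. }
    assert (Hg : span (L ++ x :: X) g).
    { assert (Hx' : span (L ++ x :: X) x)
        by (apply span_in, in_or_app; simpl; tauto).
      eapply span_ext;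
        [|exact (span_lincomb _ _ _ (/ a) (- / a) Hx' (Hinc _ Ha))].
      intros k; unfold lincomb; field; exact Ha0. }
    intros y [b Hb].
    eapply span_ext; [|exact (span_lincomb _ _ _ 1 b (Hinc _ Hb) Hg)].
    intros k; unfold lincomb; ring.
Qed.

(** The elements of [X] are exchanged into [L] from the last to the first, so that [indep] supplies
    the hypothesis [~ span X x] each time. *)
Lemma indep_length L X : indep X -> (forall x, In x X -> span L x) ->
  (length X <= length L)%nat.
Proof.
  intros HX HL.
  enough (exists L', (length L' + length X)%nat = length L /\
            forall y, span L y -> span (L' ++ X) y) as [L' [H _]] by lia.
  induction X as [|x X IH]; simpl in *.
  - exists L; split; [lia|]. intros y; now rewrite app_nil_r.
  - destruct IH as [L' [H1 H2]]; [tauto|auto|].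
    destruct (span_exchange L' X x) as [M [H3 H4]]; [auto|tauto|].
    exists M; split; [lia|auto].
Qed.

Fixpoint listed (e : nat -> seqC) (r : nat) : list seqC :=
  match r with
  | O => nil
  | S r => e (S r) :: listed e r
  end.

Lemma length_listed e r : length (listed e r) = r.
Proof. induction r; simpl; congruence. Qed.

Lemma In_listed e r x :
  In x (listed e r) <-> exists i, (1 <= i <= r)%nat /\ x = e i.
Proof.
  induction r as [|r IH]; simpl.
  - split; [easy|intros [i [Hi _]]; lia].
  - rewrite IH. split.
    + intros [<-|[i [Hi ->]]]; eexists; (split; [|reflexivity]); lia.
    + intros [i [Hi ->]]. destruct (Nat.eq_dec i (S r)) as [->|N]; [now left|].
      right; exists i; split; [lia|reflexivity].
Qed.

Lemma sum_1_S (f : nat -> C) r :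
  sum_n_m f 1 (S r) = (sum_n_m f 1 r + f (S r))%C.
Proof. apply (sum_n_Sm f 1 r). lia. Qed.

Lemma sum_1_0 (f : nat -> C) : sum_n_m f 1 0 = RtoC 0.
Proof. apply (sum_n_m_zero f 1 0). lia. Qed.

Lemma sum_1_upd (e : nat -> seqC) (c : nat -> C) a r k :
  sum_n_m (fun i => upd c (S r) a i * e i k)%C 1 (S r) =
  (sum_n_m (fun i => c i * e i k)%C 1 r + a * e (S r) k)%C.
Proof.
  rewrite sum_1_S. unfold upd at 2. rewrite Nat.eqb_refl. f_equal.
  apply sum_n_m_ext_loc. intros i Hi. unfold upd.
  now replace (Nat.eqb i (S r)) with false by (symmetry; apply Nat.eqb_neq; lia).
Qed.

Lemma span_listed_combination e r x :
  span (listed e r) x ->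
  exists c : nat -> C, forall k, x k = sum_n_m (fun i => c i * e i k)%C 1 r.
Proof.
  revert x. induction r as [|r IH]; intros x; simpl.
  - intros H; exists (fun _ => RtoC 0). intros k; now rewrite sum_1_0.
  - intros [a Ha]. destruct (IH _ Ha) as [c Hc].
    exists (upd c (S r) a). intros k.
    rewrite sum_1_upd, <- Hc. unfold lincomb. ring_C.
Qed.

Lemma combination_span_listed e r x (c : nat -> C) :
  (forall k, x k = sum_n_m (fun i => c i * e i k)%C 1 r) ->
  span (listed e r) x.
Proof.
  revert x. induction r as [|r IH]; intros x H; simpl.
  - intros k; now rewrite H, sum_1_0.
  - exists (c (S r)). apply IH. intros k. unfold lincomb.
    rewrite H, sum_1_S.  ring_C.
Qed.

Lemma indep_listed e r :
  (forall c : nat -> C,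
     (forall k, sum_n_m (fun i => c i * e i k)%C 1 r = RtoC 0) ->
     forall i, (1 <= i <= r)%nat -> c i = RtoC 0) ->
  indep (listed e r).
Proof.
  induction r as [|r IH]; simpl; [easy|].
  intros H; split.
  - intros Hs. destruct (span_listed_combination _ _ _ Hs) as [c Hc].
    assert (E : upd c (S r) (-1)%C (S r) = RtoC 0).
    { apply H; [|lia]. intros k. rewrite sum_1_upd, <- Hc. ring_C. }
    unfold upd in E. rewrite Nat.eqb_refl in E.
    apply (f_equal Re) in E. simpl in E. lra.
  - apply IH. intros c Hc i Hi.
    assert (E : upd c (S r) (RtoC 0) i = RtoC 0).
    { apply H; [|lia]. intros k. rewrite sum_1_upd, Hc. ring_C. }
    unfold upd in E.
    now replace (Nat.eqb i (S r)) with false in E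
      by (symmetry; apply Nat.eqb_neq; lia).
Qed.

Lemma mat_op_tridiag (M : imatrix) a b u i :
  (forall i j, M i j = tridiag a b i j) ->
  mat_op M u i =
  ((match i with O => RtoC 0 | S l => b l * u l end) + a i * u i
   + b i * u (S i))%C.
Proof.
  intros HM. unfold mat_op. rewrite sum_Sn, HM.
  assert (E0 : tridiag a b i i = a i) by (unfold tridiag; now rewrite Nat.eqb_refl).
  assert (E1 : tridiag a b i (S i) = b i).
  { unfold tridiag. rewrite Nat.eqb_refl.
    replace (Nat.eqb i (S i)) with false; [reflexivity|].
    symmetry; apply Nat.eqb_neq; lia. }
  rewrite E1.
  destruct i as [|l].
  - rewrite sum_O, HM, E0. change plus with Cplus. ring_C.
  - rewrite sum_Sn, HM, E0.
    assert (Hz : sum_n (fun j => M (S l) j * u j)%C l = (b l * u l)%C).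
    { assert (Hl : forall n, (n < l)%nat ->
        sum_n (fun j => M (S l) j * u j)%C n = RtoC 0).
      { assert (T : forall n, (n < l)%nat -> (M (S l) n * u n)%C = RtoC 0).
        { intros n Hn. rewrite HM. unfold tridiag.
          replace (Nat.eqb (S l) n) with false
            by (symmetry; apply Nat.eqb_neq; lia).
          replace (Nat.eqb (S (S l)) n) with false
            by (symmetry; apply Nat.eqb_neq; lia).
          replace (Nat.eqb (S l) (S n)) with false
            by (symmetry; apply Nat.eqb_neq; lia).
          ring_C. }
        induction n as [|n IH]; intros Hn.
        - rewrite sum_O; auto.
        - rewrite sum_Sn, IH, T by lia. change plus with Cplus. ring_C. }
      assert (Tl : tridiag a b (S l) l = b l).
      { unfold tridiag.
        replace (Nat.eqb (S l) l) with false
            by (symmetry; apply Nat.eqb_neq; lia).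
        replace (Nat.eqb (S (S l)) l) with false
            by (symmetry; apply Nat.eqb_neq; lia).
        now rewrite Nat.eqb_refl. }
      destruct l as [|l].
      - now rewrite sum_O, HM, Tl.
      - rewrite sum_Sn, Hl, HM, Tl by lia. change plus with Cplus. ring_C. }
    rewrite Hz. change plus with Cplus. reflexivity.
Qed.

(** * The rank of a tridiagonal matrix *)

Section Rank.

Variables a b : nat -> R.

(** In the pair [(v, m)], [v] is the coefficient of column [k] in a combination of the columns of
    the current block and [m] is what the earlier columns put into row [k]. The next coefficient
    cancels row [k]; a vanishing [b k] starts a new block. *)
Fixpoint elimination (k : nat) : R * R :=
  match k with
  | O => (1, 0)
  | S k =>
      let (v, m) := elimination k in
      if Req_EM_T (b k) 0 then (1, 0) else (- (a k * v + m) / b k, b k * v)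
  end.

Definition residue (k : nat) : R :=
  a k * fst (elimination k) + snd (elimination k).

(** If [b k <> 0], column [k + 1] has its top entry [b k] in row [k]. Otherwise the block ends at
    [k], and what remains to be counted is its reduced combination, supported in row [k]. Either way
    rows [0, ..., k] decide. *)
Definition pivot (k : nat) : R :=
  if Req_EM_T (b k) 0 then residue k else b k.

Fixpoint pivot_count (n : nat) : nat :=
  match n with
  | O => O
  | S n => if Req_EM_T (pivot n) 0 then pivot_count n else S (pivot_count n)
  end.

Definition column (k : nat) : seqC := fun l => RtoC (tridiag a b l k).

(* The combination of columns of the current block (a maximal run of nonzero
   [b]) up to column [k] that vanishes in all rows of the block above [k]. *)
Definition reduced (k : nat) : seqC := fun l =>
  if Nat.eqb l k then RtoC (residue k)
  else if Nat.eqb l (S k) then RtoC (b k * fst (elimination k))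
  else RtoC 0.

Definition basis_vector (k : nat) : seqC :=
  if Req_EM_T (b k) 0 then reduced k else column (S k).

Fixpoint basis (n : nat) : list seqC :=
  match n with
  | O => nil
  | S n => if Req_EM_T (pivot n) 0 then basis n else basis_vector n :: basis n
  end.

Lemma length_basis n : length (basis n) = pivot_count n.
Proof.
  induction n as [|n IH]; simpl; [reflexivity|].
  destruct (Req_EM_T _ _); simpl; congruence.
Qed.

Ltac eqb_cases :=
  repeat match goal with
  | |- context [Nat.eqb ?x ?y] => destruct (Nat.eqb_spec x y); try lia
  end.

Lemma column_eq k l : column k l =
  if Nat.eqb l k then RtoC (a k)
  else if Nat.eqb (S l) k then RtoC (b l)
  else if Nat.eqb l (S k) then RtoC (b k) else RtoC 0.
Proof.
  unfold column, tridiag. eqb_cases; try reflexivity; now subst.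
Qed.

Lemma reduced_0 : reduced 0 = column 0.
Proof.
  apply functional_extensionality. intros l. rewrite column_eq.
  unfold reduced, residue. simpl. eqb_cases; try reflexivity; f_equal; ring.
Qed.

Lemma reduced_S_new k : b k = 0 -> reduced (S k) = column (S k).
Proof.
  intros H. apply functional_extensionality. intros l. rewrite column_eq.
  unfold reduced, residue. simpl. destruct (elimination k) as [v m].
  destruct (Req_EM_T (b k) 0); [simpl|tauto].
  eqb_cases; try reflexivity; try (f_equal; ring).
  replace l with k by lia. now rewrite H.
Qed.

Lemma reduced_S k : b k <> 0 ->
  reduced (S k) =
  lincomb 1 (reduced k) (RtoC (fst (elimination (S k)))) (column (S k)).
Proof.
  intros H. apply functional_extensionality. intros l.
  unfold lincomb. rewrite column_eq.
  unfold reduced, residue. simpl. destruct (elimination k) as [v m].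
  destruct (Req_EM_T (b k) 0); [tauto|simpl].
  eqb_cases; subst; rewrite <- ?RtoC_mult, <- ?RtoC_plus; f_equal;
    try ring; field; exact H.
Qed.

Lemma basis_vector_above k l : (l < k)%nat -> basis_vector k l = RtoC 0.
Proof.
  intros H. unfold basis_vector. destruct (Req_EM_T _ _).
  - unfold reduced. eqb_cases; reflexivity.
  - rewrite column_eq. eqb_cases; reflexivity.
Qed.

Lemma basis_vector_pivot k : basis_vector k k = RtoC (pivot k).
Proof.
  unfold basis_vector, pivot. destruct (Req_EM_T _ _).
  - unfold reduced. eqb_cases; reflexivity.
  - rewrite column_eq. eqb_cases; reflexivity.
Qed.

Lemma basis_vector_zero k l : pivot k = 0 -> basis_vector k l = RtoC 0.
Proof.
  unfold basis_vector, pivot. destruct (Req_EM_T _ _) as [E|E]; [|tauto].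
  intros H. unfold reduced. rewrite E, H, Rmult_0_l. eqb_cases; reflexivity.
Qed.

(** The vectors are in echelon form, [basis_vector k] starting at row [k] with the entry [pivot k],
    so vanishing rows kill the coefficients one after the other. *)
Lemma span_basis_above n x :
  span (basis n) x -> (forall l, (l < n)%nat -> x l = RtoC 0) ->
  forall l, x l = RtoC 0.
Proof.
  revert x. induction n as [|n IH]; intros x; simpl; [auto|].
  destruct (Req_EM_T (pivot n) 0) as [E|E].
  - intros H Hx. apply IH; auto.
  - intros [s Hs] Hx.
    assert (H : forall l, lincomb 1 x (- s) (basis_vector n) l = RtoC 0).
    { apply IH; [exact Hs|]. intros l Hl. unfold lincomb.
      rewrite basis_vector_above, Hx by lia. ring. }
    assert (Hs0 : s = RtoC 0).
    { specialize (H n). unfold lincomb in H.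
      rewrite basis_vector_pivot, Hx in H by lia.
      assert (HC : RtoC (pivot n) <> RtoC 0) by (intros E'; apply E, RtoC_inj, E').
      replace s with (- (1 * 0 + - s * RtoC (pivot n)) / RtoC (pivot n))%C
        by (field; exact HC).
      rewrite H. field. exact HC. }
    intros l. specialize (H l). unfold lincomb in H. rewrite Hs0 in H.
    rewrite <- H. ring.
Qed.

Lemma indep_basis n : indep (basis n).
Proof.
  induction n as [|n IH]; simpl; [exact I|].
  destruct (Req_EM_T (pivot n) 0) as [E|E]; [exact IH|]. split; [|exact IH].
  intros H. apply E, RtoC_inj. rewrite <- basis_vector_pivot.
  apply (span_basis_above n); [exact H|]. intros l. apply basis_vector_above.
Qed.

Lemma span_basis_vector k n : (k < n)%nat -> span (basis n) (basis_vector k).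
Proof.
  induction n as [|n IH]; [lia|]. intros H. simpl.
  destruct (Nat.eq_dec k n) as [->|N].
  - destruct (Req_EM_T (pivot n) 0) as [E|E]; [|apply span_head].
    eapply span_ext; [|apply span_zero].
    intros l; now rewrite basis_vector_zero.
  - destruct (Req_EM_T (pivot n) 0) as [E|E]; [|apply span_cons];
      apply IH; lia.
Qed.

(** Backward induction from the end of a block: there [reduced] is itself a basis vector, and going
    from [S j] to [j] removes a multiple of column [S j], which is basis vector [j]. *)
Lemma span_reduced M k : b M = 0 -> (k <= M)%nat ->
  span (basis (S M)) (reduced k).
Proof.
  intros HM Hk. replace k with (M - (M - k))%nat by lia.
  assert (Hd : (M - k <= M)%nat) by lia.
  induction (M - k)%nat as [|d IH].
  - rewrite Nat.sub_0_r. replace (reduced M) with (basis_vector M).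
    + apply span_basis_vector; lia.
    + unfold basis_vector. destruct (Req_EM_T (b M) 0); tauto.
  - specialize (IH ltac:(lia)). remember (M - S d)%nat as j.
    replace (M - d)%nat with (S j) in IH by lia.
    pose proof (span_basis_vector j (S M) ltac:(lia)) as Hj.
    unfold basis_vector in Hj. destruct (Req_EM_T (b j) 0) as [E|E]; [exact Hj|].
    rewrite (reduced_S j E) in IH.
    eapply span_ext; [|exact (span_lincomb _ _ _ 1
      (- RtoC (fst (elimination (S j)))) IH Hj)].
    intros l; unfold lincomb. ring.
Qed.

Lemma span_column M k : b M = 0 -> (k <= M)%nat ->
  span (basis (S M)) (column k).
Proof.
  intros HM Hk. destruct k as [|k].
  - rewrite <- reduced_0. apply span_reduced; auto.
  - destruct (Req_EM_T (b k) 0) as [E|E].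
    + rewrite <- reduced_S_new by exact E. apply span_reduced; auto.
    + pose proof (span_basis_vector k (S M) ltac:(lia)) as H.
      unfold basis_vector in H. destruct (Req_EM_T (b k) 0); tauto.
Qed.

Lemma pivot_count_mono m n : (m <= n)%nat ->
  (pivot_count m <= pivot_count n)%nat.
Proof.
  induction 1; [lia|]. simpl. destruct (Req_EM_T _ _); lia.
Qed.

Lemma pivot_zero_of_max r n : (forall k, (pivot_count k <= r)%nat) ->
  pivot_count n = r -> forall k, (n <= k)%nat -> pivot k = 0.
Proof.
  intros Hr Hn k Hk. pose proof (Hr (S k)) as H.
  pose proof (pivot_count_mono n k Hk). simpl in H.
  destruct (Req_EM_T _ _); [assumption|lia].
Qed.

(** For [k > n] the block has just restarted, because [b (k - 1) = 0], and the residue is [a k]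
    itself. At [k = n] the residue may vanish by cancellation with earlier columns, so nothing is
    claimed about [a n]. *)
Lemma zero_of_pivot_zero n : (forall k, (n <= k)%nat -> pivot k = 0) ->
  (forall k, (n <= k)%nat -> b k = 0) /\ (forall k, (n < k)%nat -> a k = 0).
Proof.
  intros H.
  assert (Hb : forall k, (n <= k)%nat -> b k = 0).
  { intros k Hk. specialize (H k Hk). unfold pivot in H.
    destruct (Req_EM_T (b k) 0); auto. }
  split; [exact Hb|]. intros k Hk. specialize (H k ltac:(lia)).
  unfold pivot, residue in H. destruct (Req_EM_T (b k) 0) as [_|N].
  2: { exfalso; apply N, Hb; lia. }
  destruct k as [|k]; [lia|]. simpl in H. destruct (elimination k) as [v m].
  destruct (Req_EM_T (b k) 0) as [_|N].
  2: { exfalso; apply N, Hb; lia. }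
  simpl in H. lra.
Qed.

Variable F : imatrix.
Hypothesis F_eq : forall i j, F i j = tridiag a b i j.
Variable r : nat.
Hypothesis F_rank : has_rank (mat_op F) r.

Lemma ex_series_finite (u : nat -> R) n :
  (forall k, (n <= k)%nat -> u k = 0) -> ex_series u.
Proof.
  intros H. apply (ex_series_incr_n (V := R_NormedModule) u n).
  apply ex_series_ext with (fun k => 0).
  - intros k; symmetry; apply H; lia.
  - exists 0. apply filterlim_ext with (fun _ => 0).
    + intros m. symmetry. unfold sum_n. apply (sum_n_m_const_zero (G := R_AbelianGroup)).
    + apply filterlim_const.
Qed.

Definition unit_vector (k : nat) : seqC :=
  fun l => if Nat.eqb l k then RtoC 1 else RtoC 0.

Lemma l2_unit_vector k : l2 (unit_vector k).
Proof.
  apply (ex_series_finite _ (S k)). intros l Hl. unfold unit_vector.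
  eqb_cases. rewrite Cmod_0. ring.
Qed.

Lemma mat_op_unit_vector k l : mat_op F (unit_vector k) l = column k l.
Proof.
  rewrite (mat_op_tridiag F a b) by exact F_eq. rewrite column_eq.
  unfold unit_vector.
  destruct l as [|l]; eqb_cases; subst; try ring.
Qed.

(** Columns are images of unit vectors, so every basis vector lies in the span of the [r] vectors
    given by [has_rank]. *)
Lemma pivot_count_le n : (pivot_count n <= r)%nat.
Proof.
  destruct F_rank as [e [_ [_ He]]].
  rewrite <- length_basis, <- (length_listed e r).
  assert (Hc : forall k, span (listed e r) (column k)).
  { intros k. destruct (He (unit_vector k) (l2_unit_vector k)) as [c Hc].
    apply (combination_span_listed e r _ c).
    intros l. now rewrite <- mat_op_unit_vector. }
  assert (Hr : forall k, span (listed e r) (reduced k)).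
  { induction k as [|k IH]; [rewrite reduced_0; auto|].
    destruct (Req_EM_T (b k) 0) as [E|E].
    - rewrite reduced_S_new; auto.
    - rewrite reduced_S by exact E. apply span_lincomb; auto. }
  apply indep_length; [apply indep_basis|].
  induction n as [|n IH]; simpl; [easy|].
  destruct (Req_EM_T (pivot n) 0); [exact IH|].
  intros x [<-|Hx]; [|auto]. unfold basis_vector. destruct (Req_EM_T _ _); auto.
Qed.

Definition truncate (n : nat) (u : seqC) : seqC :=
  fun k => if Nat.ltb k n then u k else RtoC 0.

Lemma mat_op_truncate_S n u l :
  mat_op F (truncate (S n) u) l =
  lincomb 1 (mat_op F (truncate n u)) (u n) (column n) l.
Proof.
  unfold lincomb. rewrite <- mat_op_unit_vector.
  rewrite !(mat_op_tridiag F a b) by exact F_eq.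
  assert (H : forall k, truncate (S n) u k =
                        (truncate n u k + u n * unit_vector n k)%C).
  { intros k. unfold truncate, unit_vector.
    destruct (Nat.ltb_spec k (S n)); destruct (Nat.ltb_spec k n);
      eqb_cases; subst; ring. }
  destruct l; rewrite !H; ring.
Qed.

(** All columns beyond [M] vanish, so [u] may be cut off after [M + 1] coordinates and its image
    becomes a finite combination of columns. *)
Lemma mat_op_in_span M u :
  (forall k, (M <= k)%nat -> b k = 0) -> (forall k, (M < k)%nat -> a k = 0) ->
  span (basis (S M)) (mat_op F u).
Proof.
  intros Hb Ha.
  apply span_ext with (mat_op F (truncate (S M) u)).
  - intros l. rewrite !(mat_op_tridiag F a b) by exact F_eq.
    unfold truncate.
    destruct l as [|l].
    + destruct (Nat.ltb_spec 0 (S M)); [|lia].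
      destruct (Nat.ltb_spec 1 (S M)); [ring|].
      rewrite Hb by lia. ring.
    + destruct (Nat.ltb_spec l (S M)).
      2: rewrite !Hb, !Ha by lia; ring.
      destruct (Nat.ltb_spec (S l) (S M)).
      2: rewrite (Ha (S l)), (Hb (S l)) by lia; ring.
      destruct (Nat.ltb_spec (S (S l)) (S M)); [ring|].
      rewrite (Hb (S l)) by lia; ring.
  - assert (H : (S M <= S M)%nat) by lia. revert H.
    (* Only the length of the truncation varies in the induction; the basis keeps its length
       [S M]. *)
    generalize (S M) at 1 4. intros n.
    induction n as [|n IH]; intros H.
    + eapply span_ext; [|apply span_zero]. intros l.
      rewrite (mat_op_tridiag F a b) by exact F_eq. unfold truncate; simpl.
      destruct l; ring.
    + eapply span_ext; [intros l; symmetry; apply mat_op_truncate_S|].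
      apply span_lincomb; [apply IH; lia|].
      apply span_column; [apply Hb|]; lia.
Qed.

Lemma bounded_nondecreasing_attains_max (f : nat -> nat) m :
  (forall k, (f k <= m)%nat) -> exists n, forall k, (f k <= f n)%nat.
Proof.
  induction m as [|m IH]; intros H.
  - exists O. intros k. specialize (H k). lia.
  - destruct (classic (exists n, f n = S m)) as [[n Hn]|N].
    + exists n. rewrite Hn. exact H.
    + apply IH. intros k. specialize (H k).
      assert (f k <> S m) by eauto. lia.
Qed.

(** Where the bounded count is maximal all later pivots vanish, so [F] is zero from there on and the
    counted vectors span its range; independence of [e] then gives the reverse inequality. *)
Lemma pivot_count_reaches_rank : exists n, pivot_count n = r.
Proof.
  destruct (bounded_nondecreasing_attains_max pivot_count r pivot_count_le)
    as [M HM].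
  destruct (zero_of_pivot_zero M (pivot_zero_of_max _ M HM eq_refl))
    as [Hb Ha].
  exists (S M). apply Nat.le_antisymm; [apply pivot_count_le|].
  destruct F_rank as [e [He1 [He2 _]]].
  rewrite <- length_basis, <- (length_listed e r).
  apply indep_length; [now apply indep_listed|].
  intros x Hx. apply In_listed in Hx. destruct Hx as [i [Hi ->]].
  destruct (He1 i Hi) as [u [_ Hu]].
  eapply span_ext; [intros k; symmetry; apply Hu|].
  now apply mat_op_in_span.
Qed.

Lemma zero_of_pivot_count n : pivot_count n = r ->
  (forall k, (n <= k)%nat -> b k = 0) /\ (forall k, (n < k)%nat -> a k = 0).
Proof.
  intros H. apply zero_of_pivot_zero, (pivot_zero_of_max r); auto.
  exact pivot_count_le.
Qed.

End Rank.

(** * Eigenvalues of eventually free Jacobi operators *)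

Lemma ex_series_Rle (u v : nat -> R) :
  (forall k, 0 <= u k <= v k) -> ex_series v -> ex_series u.
Proof.
  intros H Hv.
  apply (ex_series_le (K := R_AbsRing) (V := R_CompleteNormedModule) u v);
    [|exact Hv].
  intros k. change (norm (u k)) with (Rabs (u k)).
  rewrite Rabs_right; [apply H|apply Rle_ge, H].
Qed.

Lemma Series_pos (u : nat -> R) k :
  (forall n, 0 <= u n) -> ex_series u -> 0 < u k -> 0 < Series u.
Proof.
  intros Hu Hs Hk. rewrite (Series_incr_n u (S k)) by (lia || exact Hs).
  simpl pred.
  assert (u k <= sum_f_R0 u k).
  { destruct k as [|k]; simpl; [lra|].
    pose proof (cond_pos_sum u k Hu). lra. }
  assert (0 <= Series (fun n => u (S k + n)%nat)); [|lra].
  replace 0 with (Series (fun _ => 0 * 0)).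
  - apply Series_le.
    + intros n. rewrite Rmult_0_l. split; [lra|apply Hu].
    + apply (ex_series_incr_n (V := R_NormedModule) u (S k)), Hs.
  - rewrite Series_scal_l. ring.
Qed.

(** * Null solutions of the free recurrence *)

Section Tail.

Variable lambda : R.
Variable t : nat -> R.
Hypothesis t_rec : forall n, t (S (S n)) = 2 * lambda * t (S n) - t n.

(** The characteristic roots of the recurrence have product 1, whence a conserved quadratic form. It
    turns the limit condition into an algebraic relation between [t 0] and [t 1] without solving the
    recurrence. *)
Lemma free_invariant n :
  t (S n) ^ 2 - 2 * lambda * t n * t (S n) + t n ^ 2 =
  t 1%nat ^ 2 - 2 * lambda * t 0%nat * t 1%nat + t 0%nat ^ 2.
Proof.
  induction n as [|n IH]; [ring|].
  etransitivity; [|exact IH]. rewrite t_rec. ring.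
Qed.

Hypothesis t_lim : is_lim_seq t 0.

Lemma free_invariant_zero :
  t 1%nat ^ 2 - 2 * lambda * t 0%nat * t 1%nat + t 0%nat ^ 2 = 0.
Proof.
  assert (H1 : is_lim_seq (fun n => t (S n)) 0)
    by (apply -> is_lim_seq_incr_1; exact t_lim).
  assert (H : is_lim_seq (fun n =>
      (t (S n) * t (S n) - 2 * lambda * (t n * t (S n))) + t n * t n)
    (0 * 0 - 2 * lambda * (0 * 0) + 0 * 0)).
  { apply is_lim_seq_plus'; [apply is_lim_seq_minus'|];
      try (apply is_lim_seq_mult'; assumption).
    apply (is_lim_seq_scal_l _ (2 * lambda) (0 * 0)).
    apply is_lim_seq_mult'; assumption. }
  apply (is_lim_seq_ext _ (fun _ =>
    t 1%nat ^ 2 - 2 * lambda * t 0%nat * t 1%nat + t 0%nat ^ 2)) in H.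
  2: { intros n. pose proof (free_invariant n). lra. }
  apply is_lim_seq_unique in H. rewrite Lim_seq_const in H.
  injection H as H. lra.
Qed.

(* On the level set 0 of the invariant, [t] is a multiple of one of the two
   powers of [z] with [lambda = (z + 1/z) / 2]; only the decaying one has
   limit 0. *)
Lemma free_decay : t 0%nat <> 0 \/ t 1%nat <> 0 ->
  exists sg w, (sg = 1 \/ sg = -1) /\ 1 < w /\
    lambda = sg * ((w + 1 / w) / 2) /\ sg * t 1%nat = t 0%nat / w.
Proof.
  intros Ht. pose proof free_invariant_zero as H0.
  destruct (Rlt_le_dec (lambda ^ 2) 1) as [Hl|Hl].
  (* For [lambda ^ 2 < 1] the quadratic form is positive definite, so its vanishing forces
     [t 0 = t 1 = 0]. *)
  { exfalso.
    assert (E : (t 1%nat - lambda * t 0%nat) ^ 2 +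
                (1 - lambda ^ 2) * t 0%nat ^ 2 = 0) by (rewrite <- H0; ring).
    assert (E0 : t 0%nat = 0).
    { pose proof (pow2_ge_0 (t 1%nat - lambda * t 0%nat)).
      apply NNPP; intros N. pose proof (pow2_gt_0 _ N). nra. }
    rewrite E0 in E, Ht. destruct Ht as [Ht|Ht]; [lra|].
    pose proof (pow2_gt_0 _ Ht). nra. }
  set (sg := if Rle_dec 0 lambda then 1 else -1).
  assert (Hsg : sg = 1 \/ sg = -1) by (unfold sg; destruct (Rle_dec _ _); auto).
  assert (Hsg2 : sg * sg = 1) by (destruct Hsg as [-> | ->]; ring).
  assert (Hab : sg * lambda = Rabs lambda).
  { unfold sg, Rabs. destruct (Rle_dec _ _); destruct (Rcase_abs _); lra. }
  assert (Habs : 1 <= Rabs lambda).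
  { rewrite <- Hab. assert (0 <= sg * lambda) by (rewrite Hab; apply Rabs_pos).
    nra. }
  set (d := sqrt (lambda ^ 2 - 1)).
  assert (Hd : d * d = lambda ^ 2 - 1) by (apply sqrt_sqrt; lra).
  assert (Hd0 : 0 <= d) by apply sqrt_pos.
  set (w := Rabs lambda + d).
  assert (Hw : 1 <= w) by (unfold w; lra).
  assert (Hinv : 1 / w = Rabs lambda - d).
  { assert (w * (Rabs lambda - d) = 1).
    { unfold w. rewrite <- Hab.
      replace ((sg * lambda + d) * (sg * lambda - d))
        with ((sg * sg) * lambda ^ 2 - d * d) by ring.
      rewrite Hsg2, Hd; ring. }
    replace 1 with (w * (Rabs lambda - d)) at 1. field. lra. }
  assert (Hlam : lambda = sg * ((w + 1 / w) / 2)).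
  { rewrite Hinv. unfold w. rewrite <- Hab.
    replace (sg * ((sg * lambda + d + (sg * lambda - d)) / 2))
      with ((sg * sg) * lambda) by field.
    rewrite Hsg2; ring. }
  (* The vanishing form splits into the growing ratio [w] and the decaying ratio [1 / w]. *)
  assert (Hfac : (sg * t 1%nat - w * t 0%nat) * (sg * t 1%nat - t 0%nat / w) = 0).
  { transitivity (sg * sg * t 1%nat ^ 2 -
      sg * ((w + 1 / w) / 2) * 2 * t 0%nat * t 1%nat + t 0%nat ^ 2).
    - field. lra.
    - rewrite <- Hlam, Hsg2, <- H0. ring. }
  (* The growing ratio would persist along the recurrence and keep [t n ^ 2] above [t 0 ^ 2 > 0],
     against the limit 0. *)
  assert (Hno : sg * t 1%nat <> w * t 0%nat).
  { intros E.
    assert (Hall : forall n, sg * t (S n) = w * t n).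
    { induction n as [|n IH]; [exact E|].
      rewrite t_rec, Hlam.
      replace (sg * (2 * (sg * ((w + 1 / w) / 2)) * t (S n) - t n))
        with ((sg * sg) * (w + 1 / w) * t (S n) - sg * t n) by (field; lra).
      replace (sg * t n) with (1 / w * (sg * (w * t n))) by (field; lra).
      rewrite <- IH, Hsg2.
      replace (sg * (sg * t (S n))) with (sg * sg * t (S n)) by ring.
      rewrite Hsg2. ring. }
    assert (T0 : t 0%nat <> 0).
    { intros E0. rewrite E0 in E, Ht. destruct Ht as [Ht|Ht]; [lra|].
      destruct Hsg as [S|S]; rewrite S in E; lra. }
    assert (Hsq : forall n, t 0%nat * t 0%nat <= t n * t n).
    { induction n as [|n IH]; [lra|].
      replace (t (S n) * t (S n)) with ((sg * t (S n)) * (sg * t (S n)))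
        by (transitivity (sg * sg * (t (S n) * t (S n))); [ring|];
            rewrite Hsg2; ring).
      rewrite Hall. pose proof (pow2_ge_0 (t n)).
      assert (1 <= w * w) by nra.
      replace (w * t n * (w * t n)) with ((w * w) * (t n * t n)) by ring. nra. }
    assert (L : Rbar_le (t 0%nat * t 0%nat) (0 * 0)).
    { apply (is_lim_seq_le (fun _ => t 0%nat * t 0%nat) (fun n => t n * t n));
        [exact Hsq|apply is_lim_seq_const|].
      now apply is_lim_seq_mult'. }
    simpl in L. pose proof (pow2_gt_0 _ T0). nra. }
  exists sg, w. repeat split; auto.
  (* At [w = 1] the two factors coincide, so the excluded case also rules out the thresholds
     [lambda = 1] and [lambda = -1]. *)
  - destruct Hw as [Hw|Hw]; [exact Hw|]. exfalso. apply Hno.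
    rewrite <- Hw in *. rewrite Rdiv_1_r in Hfac. nra.
  - nra.
Qed.

End Tail.

(** * Eigenvalues as zeros of the last Sturm term *)

Section Spectrum.

Variables a b : nat -> R.
Hypothesis b_pos : forall k, 0 < b k.
Variable K : nat.
Hypothesis a_free : forall k, (K < k)%nat -> a k = 0.
Hypothesis b_free : forall k, (K <= k)%nat -> b k = 1 / 2.

Definition eigen_rec (lambda : R) (x : nat -> R) : Prop := forall i,
  match i with O => 0 | S l => b l * x l end + a i * x i + b i * x (S i) =
  lambda * x i.

Lemma eigen_rec_zero lambda x : eigen_rec lambda x -> x O = 0 ->
  forall k, x k = 0.
Proof.
  intros H H0.
  enough (forall k, x k = 0 /\ x (S k) = 0) by firstorder.
  induction k as [|k [IH1 IH2]].
  - split; [exact H0|]. specialize (H O); simpl in H. rewrite H0 in H.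
    pose proof (b_pos 0). nra.
  - split; [exact IH2|]. specialize (H (S k)); simpl in H.
    rewrite IH1, IH2 in H. pose proof (b_pos (S k)). nra.
Qed.

Lemma eigen_rec_zero_pair lambda x k : eigen_rec lambda x ->
  x k = 0 -> x (S k) = 0 -> x O = 0.
Proof.
  intros H. induction k as [|k IH]; [auto|]. intros H1 H2.
  apply IH; [|exact H1].
  specialize (H (S k)); simpl in H. rewrite H1, H2 in H.
  pose proof (b_pos k). nra.
Qed.

Lemma eigen_rec_free lambda x n : eigen_rec lambda x ->
  x (K + S (S n))%nat = 2 * lambda * x (K + S n)%nat - x (K + n)%nat.
Proof.
  intros H. specialize (H (K + S n)%nat).
  replace (K + S n)%nat with (S (K + n)) in * by lia.
  replace (K + S (S n))%nat with (S (S (K + n))) by lia.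
  simpl in H. rewrite a_free, !b_free in H by lia. lra.
Qed.

(* [weight 0] is a junk value: it only ever multiplies the initial 0 of
   [sturm2]. *)
Definition weight (k : nat) : R :=
  tridiag a b (k - 1)%nat k * tridiag a b (k - 1)%nat k.

(* The decaying solution multiplies by [sg / w] from [K] on, so the boundary
   condition at [K] turns the last coefficient [(w + 1/w) / 2] into [w / 2]. *)
Definition coef (sg : R) (k : nat) (w : R) : R :=
  (if Nat.ltb k K then (w + 1 / w) / 2 else w / 2) - sg * a k.

Lemma weight_S k : weight (S k) = b k * b k.
Proof.
  unfold weight, tridiag. simpl (S k - 1)%nat. rewrite Nat.sub_0_r.
  replace (Nat.eqb k (S k)) with false by (symmetry; apply Nat.eqb_neq; lia).
  now rewrite Nat.eqb_refl.
Qed.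

Lemma weight_pos k : 0 < weight (S k).
Proof. rewrite weight_S. pose proof (b_pos k). nra. Qed.

Lemma joukowski_lt w v : 1 <= w -> w < v -> (w + 1 / w) / 2 < (v + 1 / v) / 2.
Proof.
  intros H1 H2.
  assert (0 < (v + 1 / v) / 2 - (w + 1 / w) / 2); [|lra].
  replace ((v + 1 / v) / 2 - (w + 1 / w) / 2)
    with ((v - w) * (v * w - 1) * / (2 * v * w)) by (field; lra).
  assert (1 < v * w) by nra.
  apply Rmult_lt_0_compat; [apply Rmult_lt_0_compat; lra|].
  apply Rinv_0_lt_compat; lra.
Qed.

(** The map from [w] to [(w + 1 / w) / 2] is nonexpansive on [[1, oo)], thresholds included; this
    turns the mesh in [w] into an error bound for eigenvalues. *)
Lemma joukowski_dist w v : 1 <= w -> w <= v ->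
  0 <= (v + 1 / v) / 2 - (w + 1 / w) / 2 <= v - w.
Proof.
  intros H1 H2. split.
  - destruct H2 as [H2| ->]; [|lra]. pose proof (joukowski_lt w v H1 H2). lra.
  - assert (1 / v <= 1 / w); [|lra].
    unfold Rdiv. rewrite !Rmult_1_l. apply Rinv_le_contravar; lra.
Qed.

Lemma coef_incr sg k w v : 1 <= w -> w < v -> coef sg k w < coef sg k v.
Proof.
  intros H1 H2. unfold coef. destruct (Nat.ltb k K); [|lra].
  pose proof (joukowski_lt w v H1 H2). lra.
Qed.

Lemma coef_cont sg k w : 1 <= w -> continuous (coef sg k) w.
Proof.
  intros H. apply (ex_derive_continuous (K := R_AbsRing) (V := R_NormedModule)).
  unfold coef. destruct (Nat.ltb k K); auto_derive; auto; lra.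
Qed.

(** The product of the off-diagonal entries converts eigenvector components into Sturm terms; the
    factor [sg ^ k] is the alternating conjugation that makes the off-diagonal entries of [-J]
    positive. *)
Fixpoint scale (sg : R) (k : nat) : R :=
  match k with O => 1 | S k => sg * b k * scale sg k end.

Lemma scale_nonzero sg k : sg = 1 \/ sg = -1 -> scale sg k <> 0.
Proof.
  intros H. induction k as [|k IH]; simpl; [lra|].
  pose proof (b_pos k). repeat apply Rmult_integral_contrapositive_currified;
    try lra; destruct H; lra.
Qed.

Lemma sturm_eigen_rec sg w x : sg = 1 \/ sg = -1 -> w <> 0 ->
  eigen_rec (sg * ((w + 1 / w) / 2)) x ->
  forall k, (k <= K)%nat ->
    sturm (coef sg) weight k w * x O = scale sg k * x k /\
    snd (sturm2 (coef sg) weight k w) * x O =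
    match k with O => 0 | S l => scale sg l * x l end.
Proof.
  intros Hsg Hw H.
  assert (Hsg2 : sg * sg = 1) by (destruct Hsg as [-> | ->]; ring).
  induction k as [|k IH]; intros Hk.
  - unfold sturm; simpl. lra.
  - destruct (IH ltac:(lia)) as [IH1 IH2]. split; [|exact IH1].
    unfold sturm in *. simpl sturm2. cbn [fst snd].
    rewrite Rmult_minus_distr_r, !Rmult_assoc, IH1, IH2.
    unfold coef. replace (Nat.ltb k K) with true
      by (symmetry; apply Nat.ltb_lt; lia).
    specialize (H k). destruct k as [|k].
    + simpl in *. set (m := (w + 1 / w) / 2) in *.
      apply (f_equal (Rmult sg)) in H. destruct Hsg as [-> | ->]; lra.
    + rewrite weight_S. simpl scale. set (m := (w + 1 / w) / 2) in *.
      apply (f_equal (Rmult (b k * scale sg k))) in H.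
      destruct Hsg as [-> | ->]; lra.
Qed.

(** Replacing [(w + 1 / w) / 2] by [w / 2] in the last coefficient subtracts [x K / (2 w)]. As
    [b K = 1 / 2], the last term is then a nonzero multiple of [sg * x (S K) - x K / w]. *)
Lemma sturm_root_iff_decay sg w x : sg = 1 \/ sg = -1 -> w <> 0 ->
  eigen_rec (sg * ((w + 1 / w) / 2)) x -> x O <> 0 ->
  (sturm (coef sg) weight (S K) w = 0 <-> sg * x (S K) = x K / w).
Proof.
  intros Hsg Hw H H0.
  assert (Hsg2 : sg * sg = 1) by (destruct Hsg as [-> | ->]; ring).
  destruct (sturm_eigen_rec sg w x Hsg Hw H K (le_n K)) as [H1 H2].
  assert (E : sturm (coef sg) weight (S K) w * x O =
              scale sg K / 2 * (sg * x (S K) - x K / w)).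
  { unfold sturm in *. simpl sturm2. cbn [fst snd].
    rewrite Rmult_minus_distr_r, !Rmult_assoc, H1, H2.
    unfold coef. rewrite Nat.ltb_irrefl.
    specialize (H K).
    assert (Hx : x (S K) = 2 * (sg * ((w + 1 / w) / 2) * x K - a K * x K
               - match K with O => 0 | S l => b l * x l end)).
    { rewrite (b_free K) in H by lia. lra. }
    rewrite Hx. clear H Hx H1 H2.
    assert (Hs : weight K * match K with O => 0 | S l => scale sg l * x l end
             = sg * scale sg K * match K with O => 0 | S l => b l * x l end).
    { destruct K as [|l]; [ring|]. rewrite weight_S. simpl scale.
      replace (sg * (sg * b l * scale sg l) * (b l * x l))
        with ((sg * sg) * (b l * scale sg l) * (b l * x l)) by ring.
      rewrite Hsg2. ring. }
    rewrite Hs. set (y := match K with O => 0 | S l => b l * x l end).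
    set (s := scale sg K).
    replace (s / 2 *
        (sg * (2 * (sg * ((w + 1 / w) / 2) * x K - a K * x K - y)) - x K / w))
      with (s * ((sg * sg) * ((w + 1 / w) / 2) - sg * a K - 1 / (2 * w)) * x K
        - sg * s * y) by (field; exact Hw).
    rewrite Hsg2. field. exact Hw. }
  pose proof (scale_nonzero sg K Hsg) as Hs.
  split; intros Hr.
  - rewrite Hr in E. assert (sg * x (S K) - x K / w = 0); [|lra].
    apply Rmult_eq_reg_l with (scale sg K / 2); lra.
  - apply Rmult_eq_reg_r with (x O); [|exact H0]. rewrite E, Hr. ring.
Qed.

Definition real_eigenvalue (lambda : R) : Prop :=
  exists x, eigen_rec lambda x /\ ex_series (fun k => x k ^ 2) /\
    exists k, x k <> 0.

Lemma eigenvalue_root lambda : real_eigenvalue lambda ->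
  exists sg w, (sg = 1 \/ sg = -1) /\ 1 < w /\
    lambda = sg * ((w + 1 / w) / 2) /\ sturm (coef sg) weight (S K) w = 0.
Proof.
  intros [x [Hx [Hs [k Hk]]]].
  assert (H0 : x O <> 0) by (intros E; apply Hk, (eigen_rec_zero lambda); auto).
  destruct (free_decay lambda (fun n => x (K + n)%nat)) as [sg [w [H1 [H2 [H3 H4]]]]].
  - intros n. now apply eigen_rec_free.
  - apply ex_series_lim_0 in Hs.
    assert (L : is_lim_seq x 0).
    { apply is_lim_seq_abs_0.
      apply is_lim_seq_ext with (fun n => sqrt (x n ^ 2)).
      - intros n. rewrite <- Rsqr_pow2. apply sqrt_Rsqr_abs.
      - rewrite <- sqrt_0. apply is_lim_seq_continuous; [|exact Hs].
        apply continuity_pt_sqrt; lra. }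
    apply is_lim_seq_ext with (fun n => x (n + K)%nat).
    + intros n; f_equal; lia.
    + apply -> is_lim_seq_incr_n; exact L.
  - rewrite Nat.add_0_r, Nat.add_1_r.
    destruct (Req_dec (x K) 0); [|now left].
    destruct (Req_dec (x (S K)) 0); [|now right].
    exfalso. apply H0. now apply (eigen_rec_zero_pair lambda x K).
  - rewrite Nat.add_0_r, Nat.add_1_r in H4.
    exists sg, w. repeat split; auto.
    apply (sturm_root_iff_decay sg w x); auto; [lra|].
    now rewrite <- H3.
Qed.

Fixpoint formal_eigenvector2 (lambda : R) (k : nat) : R * R :=
  match k with
  | O => (1, 0)
  | S k => let (x, m) := formal_eigenvector2 lambda k in
           (((lambda - a k) * x - m) / b k, b k * x)
  end.

Lemma formal_eigenvector_rec lambda :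
  eigen_rec lambda (fun k => fst (formal_eigenvector2 lambda k)).
Proof.
  intros i. cbv beta.
  assert (Hm : snd (formal_eigenvector2 lambda i) =
    match i with O => 0 | S l => b l * fst (formal_eigenvector2 lambda l) end).
  { destruct i as [|i]; [reflexivity|]. simpl.
    now destruct (formal_eigenvector2 lambda i). }
  rewrite <- Hm. simpl. destruct (formal_eigenvector2 lambda i) as [x m]; simpl.
  field. pose proof (b_pos i). lra.
Qed.

Lemma root_eigenvalue sg w : sg = 1 \/ sg = -1 -> 1 < w ->
  sturm (coef sg) weight (S K) w = 0 ->
  real_eigenvalue (sg * ((w + 1 / w) / 2)).
Proof.
  intros Hsg Hw Hr. set (lambda := sg * ((w + 1 / w) / 2)).
  assert (Hsg2 : sg * sg = 1) by (destruct Hsg as [-> | ->]; ring).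
  pose proof (formal_eigenvector_rec lambda) as H.
  remember (fun k => fst (formal_eigenvector2 lambda k)) as x eqn:Ex.
  assert (H0 : x O = 1) by now rewrite Ex.
  exists x. split; [exact H|]. split; [|exists O; lra].
  apply (sturm_root_iff_decay sg w x) in Hr; [|auto|lra|exact H|lra].
  (* The decaying ratio reproduces itself because [2 * lambda - sg * w = sg / w]. *)
  assert (Hall : forall n, sg * x (K + S n)%nat = x (K + n)%nat / w).
  { induction n as [|n IH].
    - now rewrite Nat.add_1_r, Nat.add_0_r.
    - rewrite (eigen_rec_free lambda x n H).
      replace (x (K + n)%nat) with (w * (x (K + n)%nat / w)) by (field; lra).
      rewrite <- IH. unfold lambda.
      replace (sg * (2 * (sg * ((w + 1 / w) / 2)) * x (K + S n)%nat -
               w * (sg * x (K + S n)%nat)))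
      with ((sg * sg) * (2 * ((w + 1 / w) / 2) - w) * x (K + S n)%nat)
        by ring.
      rewrite Hsg2. field. lra. }
  assert (Hgeom : forall n, x (K + n)%nat ^ 2 = x K ^ 2 * (/ (w ^ 2)) ^ n).
  { induction n as [|n IH].
    - rewrite Nat.add_0_r. ring.
    - assert (E : (sg * x (K + S n)%nat) ^ 2 = x (K + S n)%nat ^ 2).
      { transitivity (sg * sg * x (K + S n)%nat ^ 2); [ring|].
        rewrite Hsg2; ring. }
      rewrite <- E, Hall.
      transitivity (x (K + n)%nat ^ 2 * / (w ^ 2)); [field; lra|].
      rewrite IH. generalize (/ (w ^ 2)). intros g. simpl. ring. }
  apply (ex_series_incr_n (V := R_NormedModule) (fun k => x k ^ 2) K).
  apply ex_series_ext with (fun n => x K ^ 2 * (/ (w ^ 2)) ^ n).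
  - intros n. symmetry. apply Hgeom.
  - apply (ex_series_scal_l (K := R_AbsRing) (x K ^ 2) (fun n => (/ (w ^ 2)) ^ n)).
    apply ex_series_geom.
    assert (1 < w ^ 2) by nra.
    rewrite Rabs_right.
    + rewrite <- Rinv_1. apply Rinv_lt_contravar; lra.
    + left. apply Rinv_0_lt_compat; lra.
Qed.

End Spectrum.

(** Symmetry with both arguments equal to the eigenvector equates [Im z] and [- Im z] times its
    squared norm, which is positive. *)
Lemma point_spectrum_real J z : point_spectrum J z -> Im z = 0.
Proof.
  intros [u [Hu [[k Hk] He]]].
  pose proof (jacobi_self_adjoint J u u Hu Hu) as H.
  replace (mat_op (tridiag (alpha J) (beta J)) u) with (fun k => z * u k)%C in H
    by (symmetry; apply functional_extensionality; exact He).
  apply (f_equal snd) in H. unfold inner, snd in H.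
  rewrite (Series_ext _ (fun k => Im z * Cmod (u k) ^ 2)) in H.
  2: { intros n. rewrite Cmod2_alt. destruct z, (u n); simpl; ring. }
  rewrite (Series_ext (fun k => Im (u k * Cconj (z * u k))%C)
    (fun k => (- Im z) * Cmod (u k) ^ 2)) in H.
  2: { intros n. rewrite Cmod2_alt. destruct z, (u n); simpl; ring. }
  rewrite !Series_scal_l in H.
  assert (0 < Series (fun k => Cmod (u k) ^ 2)).
  { apply (Series_pos _ k); [intros; apply pow2_ge_0|exact Hu|].
    apply pow2_gt_0. intros E. apply Cmod_eq_0 in E. tauto. }
  nra.
Qed.

Lemma point_spectrum_RtoC J lambda :
  point_spectrum J (RtoC lambda) <->
  real_eigenvalue (alpha J) (beta J) lambda.
Proof.
  split.
  - intros [u [Hu [[k Hk] He]]].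
    assert (Hrec : eigen_rec (alpha J) (beta J) lambda (fun k => Re (u k)) /\
                   eigen_rec (alpha J) (beta J) lambda (fun k => Im (u k))).
    { split; intros i; specialize (He i);
      rewrite (mat_op_tridiag _ (alpha J) (beta J)) in He by reflexivity.
      - apply (f_equal Re) in He. destruct i; unfold Re in *; simpl in *; lra.
      - apply (f_equal Im) in He. destruct i; unfold Im in *; simpl in *; lra. }
    (* The matrix is real, so both parts of [u] solve the recurrence; the one that is nonzero at [k]
       serves as a real eigenvector. *)
    destruct (Req_dec (Re (u k)) 0) as [E|E].
    + exists (fun k => Im (u k)). split; [tauto|]. split.
      * apply ex_series_Rle with (2 := Hu). intros n.
        rewrite Cmod2_alt. pose proof (pow2_ge_0 (Re (u n))).
        pose proof (pow2_ge_0 (Im (u n))). lra.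
      * exists k. intros E'. apply Hk.
        destruct (u k); simpl in *; now rewrite E, E'.
    + exists (fun k => Re (u k)). split; [tauto|]. split; [|now exists k].
      apply ex_series_Rle with (2 := Hu). intros n.
      rewrite Cmod2_alt. pose proof (pow2_ge_0 (Re (u n))).
      pose proof (pow2_ge_0 (Im (u n))). lra.
  - intros [x [Hx [Hs [k Hk]]]]. exists (fun k => RtoC (x k)).
    split; [|split].
    + apply ex_series_ext with (2 := Hs). intros n.
      rewrite Cmod_R. symmetry. apply pow2_abs.
    + exists k. intros E. apply Hk, RtoC_inj, E.
    + intros i. rewrite (mat_op_tridiag _ (alpha J) (beta J)) by reflexivity.
      rewrite <- (RtoC_mult lambda), <- (Hx i).
      destruct i; now rewrite ?RtoC_plus, ?RtoC_mult.
Qed.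

(** * Programs *)

Lemma sup_dist_le (A B : C -> Prop) (d : R) :
  (forall x, A x -> exists y, B y /\ Cmod (x - y)%C <= d) ->
  Rbar_le (sup_dist A B) d.
Proof.
  intros H. unfold sup_dist, Rbar_lub.
  apply (proj2 (proj2_sig (Rbar_ex_lub _))).
  intros r [x [Hx ->]]. destruct (H x Hx) as [y [Hy Hd]].
  apply Rbar_le_trans with (Cmod (x - y)%C); [|exact Hd].
  apply (proj1 (Glb_Rbar_correct (fun r => exists b, B b /\ r = Cmod (x - b)%C))).
  now exists y.
Qed.

(** Empty sets are covered: the two conditions force [A] and [B] to be empty together, and then the
    distance is 0. *)
Lemma hausdorff_le (A B : C -> Prop) (d : R) : 0 <= d ->
  (forall x, A x -> exists y, B y /\ Cmod (x - y)%C <= d) ->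
  (forall y, B y -> exists x, A x /\ Cmod (y - x)%C <= d) ->
  Rbar_le (hausdorff A B) d.
Proof.
  intros Hd HA HB. unfold hausdorff, Rbar_max.
  repeat destruct (Rbar_le_dec _ _); auto using sup_dist_le.
Qed.

(** * Determinism, locality and total correctness of programs *)

Section Machine.

Variable M : imatrix.

Lemma exec_deterministic p s s1 s2 :
  exec M p s s1 -> exec M p s s2 -> s1 = s2.
Proof.
  intros H. revert s2.
  induction H; intros s3 H3; inversion H3; subst; try reflexivity; try tauto;
    auto;
    match goal with
    | IH : forall s2, exec M ?p ?s s2 -> ?x = s2, E : exec M ?p ?s ?y |- _ =>
        assert (x = y) by (apply IH; exact E); subst; auto
    end.
Qed.

Lemma exec_reads_incl p s s' : exec M p s s' -> incl (reads s) (reads s').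
Proof.
  induction 1; simpl; auto using incl_refl, incl_tl.
  - eapply incl_tran; eauto.
  - eapply incl_tran; eauto.
Qed.

(** A run sees the oracle only through its log of reads, which never shrinks. This yields the
    consistency condition on general algorithms. *)
Lemma exec_oracle M' p s s' : exec M p s s' ->
  (forall i j, In (i, j) (reads s') -> M' i j = M i j) -> exec M' p s s'.
Proof.
  induction 1; intros HM; try (econstructor; eassumption).
  - simpl in HM. rewrite <- HM by (left; reflexivity). constructor.
  - apply exec_Seq with s1; auto. apply IHexec1. intros i j Hij. apply HM.
    eapply exec_reads_incl; eauto.
  - apply exec_If_true; auto.
  - apply exec_If_false; auto.
  - apply exec_While_true with s1; auto. apply IHexec1. intros i j Hij. apply HM.
    eapply exec_reads_incl; eauto.
Qed.

Definition halts (p : prog) (s : state) (Q : state -> Prop) : Prop :=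
  exists s', exec M p s s' /\ Q s'.

Lemma halts_weaken p s (P Q : state -> Prop) :
  halts p s P -> (forall s', P s' -> Q s') -> halts p s Q.
Proof. intros [s' [H1 H2]] H. exists s'; auto. Qed.

Lemma halts_Skip s (Q : state -> Prop) : Q s -> halts Skip s Q.
Proof. exists s; split; [constructor|assumption]. Qed.

Lemma halts_NSet i e s (Q : state -> Prop) :
  Q (State (upd (nreg s) i (neval s e)) (rreg s) (reads s) (output s)) ->
  halts (NSet i e) s Q.
Proof. eexists; split; [constructor|assumption]. Qed.

Lemma halts_RSet i e s (Q : state -> Prop) : rdefined s e ->
  Q (State (nreg s) (upd (rreg s) (neval s i) (reval s e)) (reads s) (output s)) ->
  halts (RSet i e) s Q.
Proof. eexists; split; [constructor; assumption|assumption]. Qed.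

Lemma halts_Read d i j s (Q : state -> Prop) :
  Q (State (nreg s) (upd (rreg s) (neval s d) (M (neval s i) (neval s j)))
       ((neval s i, neval s j) :: reads s) (output s)) ->
  halts (Read d i j) s Q.
Proof. eexists; split; [constructor|assumption]. Qed.

Lemma halts_Emit e s (Q : state -> Prop) : rdefined s e ->
  Q (State (nreg s) (rreg s) (reads s) (output s ++ reval s e :: nil)) ->
  halts (Emit e) s Q.
Proof. eexists; split; [constructor; assumption|assumption]. Qed.

Lemma halts_Seq p q s (Q : state -> Prop) :
  halts p s (fun s1 => halts q s1 Q) -> halts (Seq p q) s Q.
Proof.
  intros [s1 [H1 [s2 [H2 H3]]]]. exists s2; split; [|exact H3].
  now apply exec_Seq with s1.
Qed.

Lemma halts_If t p q s (Q : state -> Prop) : tdefined s t ->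
  (teval s t -> halts p s Q) -> (~ teval s t -> halts q s Q) ->
  halts (If t p q) s Q.
Proof.
  intros Ht H1 H2. destruct (classic (teval s t)) as [H|H].
  - destruct (H1 H) as [s' [H3 H4]]. exists s'; split; [|exact H4].
    now apply exec_If_true.
  - destruct (H2 H) as [s' [H3 H4]]. exists s'; split; [|exact H4].
    now apply exec_If_false.
Qed.

(* The index of the invariant bounds the number of iterations left. *)
Lemma halts_While (I : nat -> state -> Prop) t p (Q : state -> Prop) :
  (forall d s, I d s -> tdefined s t /\
     (teval s t -> exists d', d = S d' /\ halts p s (I d')) /\
     (~ teval s t -> Q s)) ->
  forall d s, I d s -> halts (While t p) s Q.
Proof.
  intros H d. induction d as [|d IH]; intros s Hs;
    destruct (H _ _ Hs) as [Ht [H1 H2]];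
    (destruct (classic (teval s t)) as [Hc|Hc];
     [|exists s; split; [now apply exec_While_false|auto]]);
    destruct (H1 Hc) as [d' [Hd Hp]]; [easy|].
  injection Hd as <-. destruct Hp as [s1 [E1 I1]].
  destruct (IH _ I1) as [s2 [E2 Q2]].
  exists s2; split; [|exact Q2]. now apply exec_While_true with s1.
Qed.

End Machine.

Ltac run_step :=
  lazymatch goal with
  | |- halts _ (Seq _ _) _ _ => apply halts_Seq
  | |- halts _ Skip _ _ => apply halts_Skip
  | |- halts _ (NSet _ _) _ _ => apply halts_NSet
  | |- halts _ (RSet _ _) _ _ => apply halts_RSet
  | |- halts _ (Read _ _ _) _ _ => apply halts_Read
  | |- halts _ (Emit _) _ _ => apply halts_Emit
  | |- halts _ (If _ _ _) _ _ => apply halts_If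
  end;
  cbn [neval reval rdefined teval tdefined nreg rreg reads output upd Nat.eqb].

Notation rr i := (RReg (NConst i)).
Notation rset i e := (RSet (NConst i) e).
Notation "p ;; q" := (Seq p q) (at level 61, right associativity).
Notation nsucc e := (NAdd e (NConst 1)).

Definition is_zero (e : rexp) : test :=
  TAnd (TNot (TRlt e (RConst 0))) (TNot (TRlt (RConst 0) e)).

Lemma teval_is_zero s e : teval s (is_zero e) <-> reval s e = 0.
Proof. simpl. split; [intros [H1 H2]|intros ->]; lra. Qed.

(** * Locating the support of the perturbation from its rank *)

Section Support.

(* Registers: n0 the rank, n1 the row, n2 the number of nonzero pivots;
   r1, r2 the elimination pair. *)
Definition find_support : prog :=
  NSet 1 (NConst 0) ;; NSet 2 (NConst 0) ;;
  rset 1 (RConst 1) ;; rset 2 (RConst 0) ;;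
  While (TNlt (NReg 2) (NReg 0)) (
    Read (NConst 3) (NReg 1) (NReg 1) ;;
    Read (NConst 4) (NReg 1) (nsucc (NReg 1)) ;;
    rset 4 (RSub (rr 4) (RDiv (RConst 1) (RConst 2))) ;;
    rset 5 (RAdd (RMul (rr 3) (rr 1)) (rr 2)) ;;
    If (is_zero (rr 4))
      (If (is_zero (rr 5)) Skip (NSet 2 (nsucc (NReg 2))) ;;
       rset 1 (RConst 1) ;; rset 2 (RConst 0))
      (NSet 2 (nsucc (NReg 2)) ;;
       rset 2 (RMul (rr 4) (rr 1)) ;;
       rset 1 (RDiv (RSub (RConst 0) (rr 5)) (rr 4))) ;;
    NSet 1 (nsucc (NReg 1))).

Variable A : jacobi.
Let a := alpha A.
Let b := fun k => beta A k - 1 / 2.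

Lemma entry_diag k : entry A k k = alpha A k.
Proof. unfold entry, tridiag. now rewrite Nat.eqb_refl. Qed.

Lemma entry_upper k : entry A k (k + 1)%nat = beta A k.
Proof.
  unfold entry, tridiag. rewrite Nat.add_1_r, Nat.eqb_refl.
  now replace (Nat.eqb k (S k)) with false by (symmetry; apply Nat.eqb_neq; lia).
Qed.

Lemma find_support_halts r s : nreg s 0%nat = r ->
  (exists n, pivot_count a b n = r) ->
  halts (entry A) find_support s (fun s' =>
    pivot_count a b (nreg s' 1%nat) = r /\ output s' = output s).
Proof.
  intros Hr [n0 Hn0]. unfold find_support.
  do 2 (run_step; run_step). do 2 (run_step; run_step; [exact I|]).
  (* The variant [d] is the number of rows left before [n0], where the pivot count is known to be
     [r]. *)
  apply (halts_While _ (fun d s' =>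
    let k := nreg s' 1%nat in
    (k + d)%nat = n0 /\ nreg s' 0%nat = r /\
    nreg s' 2%nat = pivot_count a b k /\
    rreg s' 1%nat = fst (elimination a b k) /\
    rreg s' 2%nat = snd (elimination a b k) /\
    output s' = output s)) with (d := n0).
  2: { simpl. auto 10. }
  clear Hr. intros d [n x rd out]. cbn [nreg rreg reads output].
  intros [Hd [H0 [H2 [H3 [H4 H5]]]]]. split; [exact I|]. cbn [teval neval nreg].
  rewrite H0, H2. split; [|intros Hc; split; [|exact H5]].
  (* On exit the count is at least [r]; the row has not passed [n0], so monotonicity gives
     equality. *)
  2: { pose proof (pivot_count_mono a b (n 1%nat) n0 ltac:(lia)). lia. }
  intros Hlt. destruct d as [|d]; [rewrite Nat.add_0_r in Hd; subst; lia|].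
  exists d; split; [reflexivity|].
  do 2 (run_step; run_step). run_step; run_step; [lra|].
  run_step; run_step; [auto|].
  rewrite entry_diag, entry_upper.
  assert (Hb : beta A (n 1%nat) - 1 / 2 = b (n 1%nat)) by reflexivity.
  rewrite Hb, H3, H4. fold (a (n 1%nat)).
  fold (residue a b (n 1%nat)).
  run_step. run_step; [simpl; tauto| |];
    intros Hz; rewrite teval_is_zero in Hz; cbn in Hz.
  - run_step. apply (halts_weaken _ _ _ (fun s' =>
      nreg s' 0%nat = r /\ nreg s' 1%nat = n 1%nat /\
      nreg s' 2%nat = pivot_count a b (S (n 1%nat)) /\ output s' = output s)).
    + run_step; [simpl; tauto| |]; intros Hz'; rewrite teval_is_zero in Hz';
        cbn in Hz'; run_step; simpl; unfold pivot;
        destruct (Req_EM_T (b (n 1%nat)) 0); try contradiction;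
        destruct (Req_EM_T (residue a b (n 1%nat)) 0); try contradiction;
        repeat split; auto; lia.
    + intros [n' x' rd' out']. cbn. intros [K0 [K1 [K2 K3]]].
      run_step; run_step; [exact I|]. run_step; [exact I|].
      run_step. rewrite K1. replace (n 1%nat + 1)%nat with (S (n 1%nat)) by lia.
      simpl elimination. destruct (elimination a b (n 1%nat)) as [v m].
      destruct (Req_EM_T (b (n 1%nat)) 0); try contradiction.
      repeat split; auto; lia.
  - run_step; run_step. run_step; run_step; [auto|].
    run_step; [simpl; auto|]. run_step.
    replace (n 1%nat + 1)%nat with (S (n 1%nat)) by lia.
    simpl elimination. simpl pivot_count. unfold pivot.
    unfold residue. destruct (elimination a b (n 1%nat)) as [v m].
    destruct (Req_EM_T (b (n 1%nat)) 0) as [E|_]; try contradiction.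
    destruct (Req_EM_T (b (n 1%nat)) 0) as [E|_]; try contradiction.
    simpl. rewrite H3. repeat split; auto; try lia.
    unfold Rdiv. f_equal. ring.
Qed.

End Support.

(** * Scanning the grid for drops of the variation *)

Section Scan.

(* Registers: n1 the bound [K], n2 the index, n3 the variation, n4 its value
   at the previous grid point; r1 the point [w], r2 and r3 two consecutive
   terms of the Sturm sequence. *)
Definition compute_variation (sg : Z) : prog :=
  NSet 2 (NConst 0) ;; NSet 3 (NConst 0) ;;
  rset 2 (RConst 1) ;; rset 3 (RConst 0) ;;
  While (TNlt (NReg 2) (nsucc (NReg 1))) (
    Read (NConst 4) (NReg 2) (NReg 2) ;;
    Read (NConst 5) (NSub (NReg 2) (NConst 1)) (NReg 2) ;;
    If (TNlt (NReg 2) (NReg 1))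
      (rset 6 (RDiv (RAdd (rr 1) (RDiv (RConst 1) (rr 1))) (RConst 2)))
      (rset 6 (RDiv (rr 1) (RConst 2))) ;;
    rset 7 (RSub (RMul (RSub (rr 6) (RMul (RConst sg) (rr 4))) (rr 2))
                 (RMul (RMul (rr 5) (rr 5)) (rr 3))) ;;
    rset 3 (rr 2) ;; rset 2 (rr 7) ;;
    If (TAnd (TNot (is_zero (rr 3)))
             (TNot (TRlt (RMul (rr 3) (rr 2)) (RConst 0))))
      Skip (NSet 3 (nsucc (NReg 3))) ;;
    NSet 2 (nsucc (NReg 2))).

Definition scan (N : nat) (sg : Z) : prog :=
  rset 1 (RConst 1) ;; compute_variation sg ;;
  While (TNlt (NConst 0) (NReg 3)) (
    NSet 4 (NReg 3) ;;
    rset 1 (RAdd (rr 1) (RDiv (RConst 1) (ROfNat (NConst (S N))))) ;;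
    compute_variation sg ;;
    If (TNlt (NReg 3) (NReg 4))
      (Emit (RMul (RConst sg)
         (RDiv (RAdd (rr 1) (RDiv (RConst 1) (rr 1))) (RConst 2))))
      Skip).

Variable A : jacobi.
Variable K : nat.
Variable sg : Z.
Hypothesis sg_unit : sg = 1%Z \/ sg = (-1)%Z.

Let c := coef (alpha A) K (IZR sg).
Let q := weight (alpha A) (beta A).
Let var (w : R) := variation c q (S K) w.

Lemma compute_variation_halts s w : 1 <= w ->
  nreg s 1%nat = K -> rreg s 1%nat = w ->
  halts (entry A) (compute_variation sg) s (fun s' =>
    nreg s' 1%nat = K /\ nreg s' 4%nat = nreg s 4%nat /\
    rreg s' 1%nat = w /\ nreg s' 3%nat = var w /\ output s' = output s).
Proof.
  intros Hw HK Hw1. unfold compute_variation.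
  do 2 (run_step; run_step). do 2 (run_step; run_step; [exact I|]).
  apply (halts_While _ (fun d s' =>
    let k := nreg s' 2%nat in
    (k + d)%nat = S K /\ nreg s' 1%nat = K /\ rreg s' 1%nat = w /\
    nreg s' 4%nat = nreg s 4%nat /\ output s' = output s /\
    nreg s' 3%nat = variation c q k w /\
    rreg s' 2%nat = sturm c q k w /\
    rreg s' 3%nat = snd (sturm2 c q k w))) with (d := S K).
  2: { simpl. auto 10. }
  clear HK Hw1. intros d [n x rd out]. cbn [nreg rreg reads output].
  intros [Hd [H1 [H2 [H3 [H4 [H5 [H6 H7]]]]]]]. split; [exact I|].
  cbn [teval neval nreg]. rewrite H1.
  split; [|intros Hc; unfold var; replace (n 2%nat) with (S K) in * by lia; tauto].
  intros Hlt. destruct d as [|d]; [lia|].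
  exists d; split; [reflexivity|].
  do 2 (run_step; run_step). run_step.
  apply (halts_weaken _ _ _ (fun s' =>
    nreg s' = n /\ output s' = out /\ rreg s' 1%nat = w /\
    rreg s' 2%nat = sturm c q (n 2%nat) w /\
    rreg s' 3%nat = snd (sturm2 c q (n 2%nat) w) /\
    rreg s' 4%nat = alpha A (n 2%nat) /\
    rreg s' 5%nat = entry A (n 2%nat - 1)%nat (n 2%nat) /\
    rreg s' 6%nat - IZR sg * alpha A (n 2%nat) = c (n 2%nat) w)).
  { unfold c, coef. rewrite entry_diag.
    run_step; [exact I| |]; intros Ht; rewrite H1 in Ht;
      (run_step; [repeat split; rewrite ?H2; lra|]).
    - apply Nat.ltb_lt in Ht. rewrite Ht, H2. auto 10.
    - apply Nat.ltb_nlt in Ht. rewrite Ht, H2. auto 10. }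
  intros [n' x' rd' out']. cbn [nreg rreg reads output].
  intros [-> [-> [K1 [K2 [K3 [K4 [K5 K6]]]]]]].
  run_step; run_step; [auto|].
  run_step; run_step; [auto|].
  run_step; run_step; [auto|].
  rewrite K2, K3, K4, K5, K6.
  (* This is definitional even in row 0, because [weight] uses the same truncated index [k - 1] as
     the program's read. *)
  assert (Es : c (n 2%nat) w * sturm c q (n 2%nat) w -
    entry A (n 2%nat - 1)%nat (n 2%nat) * entry A (n 2%nat - 1)%nat (n 2%nat) *
    snd (sturm2 c q (n 2%nat) w) = sturm c q (S (n 2%nat)) w) by reflexivity.
  rewrite Es. run_step.
  apply (halts_weaken _ _ _ (fun s' =>
    nreg s' 1%nat = K /\ nreg s' 2%nat = n 2%nat /\
    nreg s' 4%nat = nreg s 4%nat /\ output s' = output s /\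
    rreg s' 1%nat = w /\
    nreg s' 3%nat = variation c q (S (n 2%nat)) w /\
    rreg s' 2%nat = sturm c q (S (n 2%nat)) w /\
    rreg s' 3%nat = snd (sturm2 c q (S (n 2%nat)) w))).
  { run_step; [simpl; tauto| |]; intros Ht; rewrite teval_is_zero in Ht;
      cbn [reval neval rreg upd Nat.eqb] in Ht; run_step.
    - rewrite variation_S_not by (unfold drops; lra).
      repeat split; auto.
    - rewrite variation_S by (unfold drops; lra).
      repeat split; auto. lia. }
  intros [n'' x'' rd'' out'']. cbn [nreg rreg reads output].
  intros [L1 [L2 [L3 [L4 [L5 [L6 [L7 L8]]]]]]].
  run_step. rewrite L2. replace (n 2%nat + 1)%nat with (S (n 2%nat)) by lia.
  repeat split; auto. lia.
Qed.

Lemma var_decr w v : 1 <= w -> w <= v -> (var v <= var w)%nat.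
Proof.
  apply variation_decr.
  - apply weight_pos, beta_pos.
  - apply coef_incr.
Qed.

Variable N : nat.
Let h := 1 / INR (S N).
Let grid (j : nat) := 1 + INR j * h.

Lemma mesh_pos : 0 < h.
Proof. apply Rdiv_lt_0_compat; [lra|apply lt_0_INR; lia]. Qed.

Lemma grid_le i j : (i <= j)%nat -> 1 <= grid i <= grid j.
Proof.
  intros H. apply le_INR in H. pose proof (pos_INR i). pose proof mesh_pos.
  unfold grid. nra.
Qed.

Lemma grid_S j : grid (S j) = grid j + h.
Proof. unfold grid. rewrite S_INR. ring. Qed.

Lemma var_eventually_zero : exists j, var (grid j) = O.
Proof.
  assert (HB : forall n, exists B, 1 <= B /\ forall k, (k < n)%nat ->
            1 + Rabs (q k) + Rabs (alpha A k) <= B).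
  { induction n as [|n [B [HB1 HB]]].
    - exists 1. split; [lra|]. intros k Hk; lia.
    - exists (Rmax B (1 + Rabs (q n) + Rabs (alpha A n))). split.
      + eapply Rle_trans; [exact HB1|apply Rmax_l].
      + intros k Hk. destruct (Nat.eq_dec k n) as [->|Hn]; [apply Rmax_r|].
        eapply Rle_trans; [apply HB; lia|apply Rmax_l]. }
  destruct (HB (S K)) as [B [HB1 HB2]].
  destruct (INR_unbounded (2 * B / h)) as [j Hj].
  exists j. unfold var.
  (* The factor 2 compensates the coefficient at [K], which grows only like [w / 2]. *)
  assert (Hw : 2 * B <= grid j).
  { pose proof mesh_pos. unfold grid.
    apply Rmult_gt_compat_r with (r := h) in Hj; [|assumption].
    unfold Rdiv at 1 in Hj. rewrite Rmult_assoc, Rinv_l in Hj by lra. lra. }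
  apply variation_zero. intros k Hk. specialize (HB2 k Hk).
  assert (Hs : IZR sg * alpha A k <= Rabs (alpha A k)).
  { destruct sg_unit as [-> | ->]; unfold Rabs; destruct (Rcase_abs _); lra. }
  assert (0 < 1 / grid j).
  { apply Rdiv_lt_0_compat; [lra|]. pose proof (grid_le 0 j ltac:(lia)). lra. }
  unfold c, coef. destruct (Nat.ltb k K); lra.
Qed.

Let emitted (x : R) : Prop := exists j,
  (var (grid (S j)) < var (grid j))%nat /\
  x = IZR sg * ((grid (S j) + 1 / grid (S j)) / 2).

Lemma scan_halts s : nreg s 1%nat = K ->
  halts (entry A) (scan N sg) s (fun s' => nreg s' 1%nat = K /\
    forall x, In x (output s') <-> In x (output s) \/ emitted x).
Proof.
  intros HK. destruct var_eventually_zero as [j0 Hj0].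
  unfold scan. run_step; run_step; [exact I|]. run_step.
  eapply halts_weaken.
  { apply (compute_variation_halts _ (grid 0)); [|exact HK|].
    - apply (grid_le 0 0); lia.
    - cbn [rreg upd Nat.eqb]. unfold grid. rewrite INR_0. ring. }
  intros [n x rd out]. cbn [nreg rreg reads output].
  intros [H1 [_ [H2 [H3 H4]]]].
  apply (halts_While _ (fun d s' => exists j, (j + d)%nat = j0 /\
    nreg s' 1%nat = K /\ rreg s' 1%nat = grid j /\
    nreg s' 3%nat = var (grid j) /\
    forall y, In y (output s') <-> In y (output s) \/ exists i, (i < j)%nat /\
      (var (grid (S i)) < var (grid i))%nat /\
      y = IZR sg * ((grid (S i) + 1 / grid (S i)) / 2))) with (d := j0).
  2: { exists O. cbn [nreg rreg output]. repeat split; auto.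
       - subst out; auto.
       - subst out. intros [Hy|[i [Hi _]]]; [exact Hy|lia]. }
  clear n x rd out H1 H2 H3 H4.
  intros d [n x rd out]. cbn [nreg rreg reads output].
  intros [j [Hd [H1 [H2 [H3 H4]]]]].
  split; [exact I|]. cbn [teval neval nreg]. rewrite H3. split.
  - intros Hpos. destruct d as [|d].
    { rewrite Nat.add_0_r in Hd. subst j. rewrite Hj0 in Hpos. lia. }
    exists d; split; [reflexivity|].
    run_step; run_step.
    pose proof mesh_pos as Hh. unfold h in Hh.
    run_step; run_step; [repeat split; apply not_0_INR; lia|].
    run_step. eapply halts_weaken.
    { apply (compute_variation_halts _ (grid (S j))); [|exact H1|].
      - apply (grid_le (S j) (S j)); lia.
      - cbn [rreg upd Nat.eqb]. rewrite H2, grid_S. reflexivity. }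
    intros [n' x' rd' out']. cbn [nreg rreg reads output upd Nat.eqb].
    intros [K1 [K2 [K3 [K4 K5]]]]. rewrite H3 in K2.
    pose proof (grid_le (S j) (S j) (le_n _)) as [Hg _].
    run_step; [exact I| |]; rewrite K2, K4; intros Hlt; run_step.
    + repeat split; rewrite ?K3; lra.
    + exists (S j). cbn [nreg rreg output]. rewrite K1, K3, K4.
      repeat split; try lia; rewrite K5, in_app_iff, H4.
      * intros [[Hy|[i [Hi Hy]]]|[<-|[]]]; [now left| |].
        -- right; exists i; split; [lia|exact Hy].
        -- right; exists j; split; [lia|]. split; [exact Hlt|reflexivity].
      * intros [Hy|[i [Hi [Hy ->]]]]; [now left; left|].
        destruct (Nat.eq_dec i j) as [->|Hn].
        -- right; left; reflexivity.
        -- left; right; exists i; repeat split; [lia|exact Hy].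
    + exists (S j). cbn [nreg rreg output]. rewrite K1, K3, K4.
      repeat split; try lia; rewrite K5, H4.
      * intros [Hy|[i [Hi Hy]]]; [now left|].
        right; exists i; split; [lia|exact Hy].
      * intros [Hy|[i [Hi [Hy ->]]]]; [now left|].
        destruct (Nat.eq_dec i j) as [->|Hn]; [contradiction|].
        right; exists i; repeat split; [lia|exact Hy].
  - intros Hz. split; [exact H1|]. intros y. rewrite H4.
    split; (intros [Hy|Hy]; [now left|right]).
    + destruct Hy as [i [_ Hy]]. now exists i.
    (* [emitted] does not bound the index: once the count is 0 it stays 0, so no cell after the exit
       can drop. *)
    + destruct Hy as [i Hy]. exists i. split; [|exact Hy].
      apply Nat.nle_gt. intros Hi. destruct (grid_le j i Hi) as [Hg1 Hg2].
      pose proof (var_decr _ _ Hg1 Hg2). lia.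
Qed.

(** The drop puts a zero into a cell that is open on the left, whence the strict [1 < w] needed for
    an eigenvalue; the emitted point is the image of the right end of that cell. *)
Lemma emitted_near_root x : emitted x ->
  exists w, 1 < w /\ sturm c q (S K) w = 0 /\
    Rabs (x - IZR sg * ((w + 1 / w) / 2)) <= h.
Proof.
  intros [j [Hj ->]].
  destruct (grid_le j (S j) ltac:(lia)) as [Hg _]. pose proof (grid_S j) as HS.
  pose proof mesh_pos.
  destruct (root_of_variation_drop c q (weight_pos _ _ (beta_pos A))
    (coef_incr _ _ _) (coef_cont _ _ _) (S K) (grid j) (grid (S j)))
    as [w [Hw Hr]]; [exact Hg|lra|exact Hj|].
  exists w. split; [lra|]. split; [exact Hr|].
  destruct (joukowski_dist w (grid (S j))) as [D1 D2]; [lra|lra|].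
  rewrite <- Rmult_minus_distr_l, Rabs_mult.
  rewrite (Rabs_right (_ - _)) by lra.
  replace (Rabs (IZR sg)) with 1.
  - lra.
  - destruct sg_unit as [-> | ->]; [rewrite Rabs_right|rewrite Rabs_left]; lra.
Qed.

Lemma root_near_emitted w : 1 < w -> sturm c q (S K) w = 0 ->
  exists x, emitted x /\ Rabs (x - IZR sg * ((w + 1 / w) / 2)) <= h.
Proof.
  intros Hw Hr. pose proof mesh_pos as Hh.
  destruct (INR_unbounded (w / h)) as [j1 Hj1].
  assert (Hup : w <= grid j1).
  { unfold grid. apply Rmult_gt_compat_r with (r := h) in Hj1; [|assumption].
    unfold Rdiv at 1 in Hj1. rewrite Rmult_assoc, Rinv_l in Hj1 by lra. lra. }
  (* The cell ends at the first grid point not below [w]; it has a left end because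
     [grid 0 = 1 < w]. *)
  assert (Hj : exists j, grid j < w <= grid (S j)).
  { clear Hj1. induction j1 as [|j IH].
    - unfold grid in Hup. simpl in Hup. lra.
    - destruct (Rlt_dec (grid j) w); [now exists j|]. apply IH; lra. }
  destruct Hj as [j Hj]. pose proof (grid_S j) as HS.
  destruct (grid_le j (S j) ltac:(lia)) as [Hg _].
  exists (IZR sg * ((grid (S j) + 1 / grid (S j)) / 2)). split.
  - exists j. split; [|reflexivity].
    apply (variation_drop_of_root c q (weight_pos _ _ (beta_pos A))
      (coef_incr _ _ _) (S K) _ _ w); auto.
  - destruct (joukowski_dist w (grid (S j))) as [D1 D2]; [lra|lra|].
    rewrite <- Rmult_minus_distr_l, Rabs_mult.
    rewrite (Rabs_right (_ - _)) by lra.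
    replace (Rabs (IZR sg)) with 1.
    + lra.
    + destruct sg_unit as [-> | ->]; [rewrite Rabs_right|rewrite Rabs_left]; lra.
Qed.

End Scan.

(** Execution is a relation, so the outcome is chosen by [epsilon]; determinism identifies it with
    the result of any halting run. *)
Definition final_state (p : prog) (x : R) (A : jacobi) (r : nat) : state :=
  epsilon (inhabits (init 0 0)) (exec (entry A) p (init r x)).

Lemma final_state_spec p x A r (Q : state -> Prop) :
  halts (entry A) p (init r x) Q ->
  exec (entry A) p (init r x) (final_state p x A r) /\ Q (final_state p x A r).
Proof.
  intros [s [Hs HQ]].
  assert (H : exec (entry A) p (init r x) (final_state p x A r))
    by (unfold final_state; apply epsilon_spec; now exists s).
  split; [exact H|]. now rewrite <- (exec_deterministic _ _ _ _ _ Hs H).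
Qed.

(** Halting is the only obligation: with the read log as [Lambda], an input agreeing on the log has
    the very same run. *)
Lemma program_algorithm {O : Type} (p : prog) (x : R) (result : state -> O)
    (Omega : jacobi -> nat -> Prop) :
  (forall A r, Omega A r -> halts (entry A) p (init r x) (fun _ => True)) ->
  general_algorithm Omega (fun A r => result (final_state p x A r))
    (fun A r => reads (final_state p x A r)) /\
  computed_by p x result Omega (fun A r => result (final_state p x A r))
    (fun A r => reads (final_state p x A r)).
Proof.
  intros H. split.
  - intros A B r HA HB Hread.
    destruct (final_state_spec _ _ _ _ _ (H A r HA)) as [EA _].
    destruct (final_state_spec _ _ _ _ _ (H B r HB)) as [EB _].
    pose proof (exec_oracle _ _ _ _ _ EA Hread) as EB'.
    rewrite (exec_deterministic _ _ _ _ _ EB EB'). split; reflexivity.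
  - intros A r HA.
    destruct (final_state_spec _ _ _ _ _ (H A r HA)) as [EA _].
    exists (final_state p x A r). split; [exact EA|]. split; reflexivity.
Qed.

Definition spectrum_prog (N : nat) : prog :=
  find_support ;; scan N 1 ;; scan N (-1).

Definition finite_rank_input (A : jacobi) (r : nat) : Prop :=
  has_rank (mat_op (perturbation A)) r.

Lemma perturbation_tridiag A i j : perturbation A i j =
  tridiag (alpha A) (fun k => beta A k - 1 / 2) i j.
Proof.
  unfold perturbation, entry, Defs.Delta, tridiag.
  destruct (Nat.eqb i j); [ring|].
  destruct (Nat.eqb (S i) j); [ring|].
  destruct (Nat.eqb i (S j)); ring.
Qed.

Lemma Cmod_sub_RtoC x y : Cmod (RtoC x - RtoC y)%C = Rabs (x - y).
Proof. now rewrite <- RtoC_minus, Cmod_R. Qed.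

Lemma spectrum_prog_halts N A r : finite_rank_input A r ->
  halts (entry A) (spectrum_prog N) (init r 0) (fun s =>
    Rbar_le (hausdorff (embed (set_result s)) (point_spectrum A))
            (1 / INR (S N))).
Proof.
  intros HA. unfold finite_rank_input in HA.
  pose proof (perturbation_tridiag A) as HF.
  unfold spectrum_prog. apply halts_Seq. eapply halts_weaken.
  { apply (find_support_halts A r); [reflexivity|].
    now apply (pivot_count_reaches_rank _ _ (perturbation A) HF). }
  intros s1 [Hs1 Ho1]. cbn in Ho1.
  (* The row at which the first loop stops serves as [K]: off-diagonal entries are free from [K] on,
     diagonal ones only from [K + 1] on. *)
  destruct (zero_of_pivot_count _ _ _ HF r HA _ Hs1) as [Hb Ha].
  remember (nreg s1 1%nat) as K eqn:HK.
  assert (Hb' : forall k, (K <= k)%nat -> beta A k = 1 / 2)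
    by (intros k Hk; specialize (Hb k Hk); cbv beta in Hb; lra).
  apply halts_Seq. eapply halts_weaken.
  { apply (scan_halts A K 1 (or_introl eq_refl) N). auto. }
  intros s2 [Hs2 Ho2]. eapply halts_weaken.
  { apply (scan_halts A K (-1) (or_intror eq_refl) N). exact Hs2. }
  intros s3 [_ Ho3].
  assert (Hroot : forall sg w, sg = 1%Z \/ sg = (-1)%Z -> 1 < w ->
    sturm (coef (alpha A) K (IZR sg)) (weight (alpha A) (beta A)) (S K) w = 0 ->
    point_spectrum A (RtoC (IZR sg * ((w + 1 / w) / 2)))).
  { intros sg w Hsg Hw Hr. apply point_spectrum_RtoC.
    apply (root_eigenvalue _ _ (beta_pos A) K Ha Hb'); auto.
    destruct Hsg as [-> | ->]; auto. }
  apply hausdorff_le.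
  - left. apply mesh_pos.
  - intros z [x [Hx ->]]. unfold set_result in Hx.
    rewrite Ho3, Ho2, Ho1 in Hx.
    destruct Hx as [[[]|Hx]|Hx];
      (apply emitted_near_root in Hx; [|auto]);
      destruct Hx as [w [Hw [Hr Hd]]].
    + eexists. split; [exact (Hroot 1%Z w (or_introl eq_refl) Hw Hr)|].
      now rewrite Cmod_sub_RtoC.
    + eexists. split; [exact (Hroot (-1)%Z w (or_intror eq_refl) Hw Hr)|].
      now rewrite Cmod_sub_RtoC.
  - intros z Hz. pose proof (point_spectrum_real A z Hz) as Him.
    assert (Ez : z = RtoC (Re z)) by (destruct z; simpl in *; now rewrite Him).
    rewrite Ez in Hz. apply point_spectrum_RtoC in Hz.
    apply (eigenvalue_root _ _ (beta_pos A) K Ha Hb') in Hz.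
    destruct Hz as [sg [w [Hsg [Hw [Hl Hr]]]]].
    assert (Hx : exists x, set_result s3 x /\
                           Rabs (x - sg * ((w + 1 / w) / 2)) <= 1 / INR (S N)).
    { destruct Hsg as [-> | ->].
      - destruct (root_near_emitted A K 1 (or_introl eq_refl) N w Hw Hr)
          as [x [Hx Hd]].
        exists x. split; [|exact Hd]. apply Ho3. left. apply Ho2. now right.
      - destruct (root_near_emitted A K (-1) (or_intror eq_refl) N w Hw Hr)
          as [x [Hx Hd]].
        exists x. split; [|exact Hd]. apply Ho3. now right. }
    destruct Hx as [x [Hx Hd]]. exists (RtoC x). split.
    + exists x. split; [exact Hx|reflexivity].
    + rewrite Ez, Cmod_sub_RtoC, Rabs_minus_sym, Hl. exact Hd.
Qed.

(** The mesh bound is uniform over the inputs, so the index depends on [eps] alone and no entry is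
    read. *)
Definition index_prog : prog :=
  NSet 0 (NConst 0) ;;
  While (TNot (TRlt (RConst 1) (RMul (rr 0) (ROfNat (nsucc (NReg 0))))))
    (NSet 0 (nsucc (NReg 0))).

Lemma mesh_eventually_small eps : 0 < eps -> exists N0, forall N,
  (N0 <= N)%nat -> 1 < eps * INR (S N).
Proof.
  intros He. destruct (INR_unbounded (1 / eps)) as [N0 H0]. exists N0.
  intros N HN. apply Rmult_gt_compat_l with (r := eps) in H0; [|exact He].
  replace (eps * (1 / eps)) with 1 in H0 by (field; lra).
  apply Rlt_le_trans with (1 := H0). apply Rmult_le_compat_l; [lra|].
  apply le_INR; lia.
Qed.

Lemma mesh_lt eps N : 1 < eps * INR (S N) -> 1 / INR (S N) < eps.
Proof.
  intros H. assert (Hp : 0 < INR (S N)) by (apply lt_0_INR; lia).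
  apply Rmult_lt_reg_r with (INR (S N)); [exact Hp|].
  replace (1 / INR (S N) * INR (S N)) with 1 by (field; lra). exact H.
Qed.

Lemma index_prog_halts M r eps : 0 < eps ->
  halts M index_prog (init r eps) (fun s => 1 < eps * INR (S (nreg s 0%nat))).
Proof.
  intros He. destruct (mesh_eventually_small eps He) as [N0 HN0].
  unfold index_prog. run_step. run_step.
  apply (halts_While _ (fun d s => (N0 <= nreg s 0%nat + d)%nat /\
    rreg s 0%nat = eps)) with (d := N0).
  2: { split; [simpl; lia|reflexivity]. }
  intros d [n x rd out]. cbn [nreg rreg]. intros [H1 H2].
  split; [simpl; auto|].
  cbn [teval reval neval nreg rreg]. rewrite Nat.add_1_r, H2.
  split; [|intros Hc; lra].
  intros Hc. destruct d as [|d].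
  { exfalso. apply Hc, HN0. lia. }
  exists d; split; [reflexivity|]. run_step. split; [lia|exact H2].
Qed.

Theorem theorem6p8 :
  computable_with_error_control
    (fun (J : jacobi) (r : nat) => has_rank (mat_op (perturbation J)) r)
    point_spectrum.
Proof.
  exists (fun N A r => set_result (final_state (spectrum_prog N) 0 A r)),
         (fun N A r => reads (final_state (spectrum_prog N) 0 A r)).
  (* One explicit bound serves both the convergence and the guarantee for the computed index. *)
  assert (Hbound : forall eps N A r, 1 < eps * INR (S N) ->
    has_rank (mat_op (perturbation A)) r ->
    Rbar_lt (hausdorff (embed (set_result (final_state (spectrum_prog N) 0 A r)))
               (point_spectrum A)) eps).
  { intros eps N A r Heps HA.
    destruct (final_state_spec _ _ _ _ _ (spectrum_prog_halts N A r HA)) as [_ H].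
    apply Rbar_le_lt_trans with (1 := H). now apply mesh_lt. }
  split; [|split].
  - intros N.
    destruct (program_algorithm (spectrum_prog N) 0 set_result finite_rank_input)
      as [H1 H2].
    { intros A r HA. eapply halts_weaken; [|easy].
      now apply spectrum_prog_halts. }
    split; [exact H1|]. exists (spectrum_prog N). exact H2.
  - intros A r HA eps Heps.
    destruct (mesh_eventually_small eps Heps) as [N0 HN0].
    exists N0. intros N HN. apply Hbound; auto.
  - exists index_prog,
      (fun eps A r => nat_result (final_state index_prog eps A r)),
      (fun eps A r => reads (final_state index_prog eps A r)).
    intros eps Heps.
    destruct (program_algorithm index_prog eps nat_result finite_rank_input)
      as [H1 H2].
    { intros A r _. eapply halts_weaken; [|easy]. now apply index_prog_halts. }
    split; [exact H1|]. split; [exact H2|]. intros A r HA. apply Hbound; [|exact HA].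
    apply (final_state_spec index_prog eps A r
      (fun s => 1 < eps * INR (S (nreg s 0%nat)))).
    now apply index_prog_halts.
Qed.
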